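(* Let $n\ge2$, let $\tau=2\ell-1+\varepsilon$ with $\ell\ge1$, $\varepsilon\in\{0,1\}$, and let the potential $h$ satisfy $h^{(\tau)}\ge0$ on $[-1,1)$. Let $(C,W)$ be a weighted spherical $\tau$-design on $\mathbb{S}^{n-1}$ with $N$ points and maximal inner product $s=s(C)\in[-1,1)$. Assume that, with $q=\tau$, $s\in I_q$ and $N_q=L_q(n,s)$ satisfies $D(n,q)<N_q\le D(n,q+1)$. Then $$E_h(C,W)\ \le\ \frac{(N_W-N_q)\,g_T(1)}{N_WN_q}+\sum_{i=0}^{\ell-1+\varepsilon}\rho_i^{(n,s)}\,h(\alpha_i^{(n,s)}),$$ where $N_W=1/\sum_{i=1}^Nw_i^2$ and the parameters $\alpha_i^{(n,s)},\rho_i^{(n,s)}$, the multiset $T$ and the Hermite interpolant $g_T$ are defined in the context.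
   Context: **Energy and designs.** $\mathbb{S}^{n-1}$ is the unit sphere in $\mathbb{R}^n$. A weighted spherical code $(C,W)$ consists of an $N$-tuple $C=(x_1,\dots,x_N)$ of distinct points of $\mathbb{S}^{n-1}$ and weights $W=(w_1,\dots,w_N)$, $w_i>0$, $\sum_iw_i=1$; $s(C)=\max_{i\ne j}x_i\cdot x_j$. A potential is a continuous extended-real-valued $h:[-1,1]\to\mathbb{R}\cup\{+\infty\}$, finite on $[-1,1)$, and $E_h(C,W)=\sum_{i\ne j}w_iw_jh(x_i\cdot x_j)$. $(C,W)$ is a weighted spherical $\tau$-design if $M_r(C,W):=\sum_{i,j=1}^Nw_iw_jP_r^{(n)}(x_i\cdot x_j)=0$ for $1\le r\le\tau$. **Gegenbauer polynomials.** $d\mu_n(t)=\gamma_n(1-t^2)^{(n-3)/2}dt$ is the probability measure on $[-1,1]$ with $\gamma_n=\Gamma(n/2)/(\sqrt{\pi}\,\Gamma((n-1)/2))$; $P_i^{(n)}$ is the degree $i$ orthogonal polynomial for $\mu_n$ with $P_i^{(n)}(1)=1$. For a real polynomial $f$, $f_0=\int f\,d\mu_n$ is its zeroth Gegenbauer coefficient. **Levenshtein parameters.** For $q=2\ell-1+\varepsilon$, put $D(n,q)=\binom{n+\ell-2+\varepsilon}{n-1}+\binom{n+\ell-2}{n-1}$. For $a,b\in\{0,1\}$ let $t_\ell^{a,b}$ be the largest zero of the Jacobi polynomial $P_\ell^{(a+(n-3)/2,\,b+(n-3)/2)}$, $\ell\ge1$, with $t_0^{1,1}=-1$, and let $I_q=[t_{\ell-1+\varepsilon}^{1,1-\varepsilon},t_\ell^{1,\varepsilon}]$.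 The Levenshtein function is $$L_q(n,s)=\binom{\ell+n-3+\varepsilon}{n-2}\left[\frac{2\ell+n-3+2\varepsilon}{n-1}-\frac{(1+s)^{\varepsilon}\left(P_{\ell-1+\varepsilon}^{(n)}(s)-P_{\ell+\varepsilon}^{(n)}(s)\right)}{(1-s)\left(\varepsilon P_\ell^{(n)}(s)+P_{\ell+\varepsilon}^{(n)}(s)\right)}\right],\quad s\in I_q,$$ which is known to be an increasing bijection from $I_q$ onto $[D(n,q),D(n,q+1)]$. The Levenshtein polynomial $f_q^{(n,s)}$ is the monic multiple of $(1+t)^{\varepsilon}(t-s)K_{\ell-1}(t,s)^2$, where $K_{\ell-1}$ is the reproducing kernel of the space of polynomials of degree at most $\ell-1$ in $L^2((1-t)(1+t)^{\varepsilon}d\mu_n)$. Its distinct roots are $\alpha_0^{(n,s)}<\dots<\alpha_{\ell-1+\varepsilon}^{(n,s)}=s$, with $\alpha_0^{(n,s)}=-1$ when $\varepsilon=1$. The weights are $\rho_i^{(n,s)}=\left(\int\ell_i\,d\mu_n-\ell_i(1)/N_q\right)/\ell_i(\alpha_i^{(n,s)})$ with $\ell_i(t)=\prod_{j\ne i}(t-\alpha_j^{(n,s)})$. It is known that $f_0=\frac{f(1)}{N_q}+\sum_{i=0}^{\ell-1+\varepsilon}\rho_i^{(n,s)}f(\alpha_i^{(n,s)})$ for every polynomial $f$ of degree at most $q$. **Multiset $T$ (with $q=\tau$).** If $\tau=2\ell-1$, $T$ contains each of $\alpha_0^{(n,s)},\dots,\alpha_{\ell-2}^{(n,s)}$ twice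 and $\alpha_{\ell-1}^{(n,s)}=s$ once. If $\tau=2\ell$, $T$ contains $\alpha_0^{(n,s)}=-1$ once, each of $\alpha_1^{(n,s)},\dots,\alpha_{\ell-1}^{(n,s)}$ twice, and $\alpha_\ell^{(n,s)}=s$ once. The polynomial $g_T$ is the unique polynomial of degree at most $\tau-1$ agreeing with $h$ at simple nodes of $T$ and agreeing with $h$ in value and first derivative at double nodes of $T$. *)

(* Defs.v *)
From HB Require Import structures.
From mathcomp Require Import all_boot all_order all_algebra.
From mathcomp Require Import polyrcf.
From mathcomp Require Import all_classical all_reals all_analysis.

Set Implicit Arguments.
Unset Strict Implicit.
Unset Printing Implicit Defensive.

Import Order.TTheory GRing.Theory Num.Theory.
Import numFieldNormedType.Exports.

Local Open Scope classical_set_scope.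
Local Open Scope ring_scope.

Section Codes.
Variables (R : realType) (n N : nat).
Implicit Types (x : 'I_N -> 'rV[R]_n) (w : 'I_N -> R).

Definition dotp (u v : 'rV[R]_n) : R := \sum_(k < n) u 0 k * v 0 k.

Definition weighted_code x w : Prop :=
  [/\ forall i, dotp (x i) (x i) = 1,
      injective x,
      forall i, 0 < w i
    & \sum_(i < N) w i = 1].

(* The neutral element -1 never exceeds an inner product of unit vectors, so
   this is the true maximum as soon as 2 <= N. *)
Definition max_inner x : R :=
  \big[Num.max/-1]_(ij : 'I_N * 'I_N | ij.1 != ij.2) dotp (x ij.1) (x ij.2).

Definition energy (h : R -> \bar R) x w : \bar R :=
  (\sum_(i < N) \sum_(j < N | j != i)
     (w i * w j)%:E * h (dotp (x i) (x j)))%E.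

Definition weight_card w : R := (\sum_(i < N) w i ^+ 2)^-1.

End Codes.

Section Potentials.
Variable R : realType.
Implicit Types (h : R -> \bar R) (f : R -> R) (D : set R).

(* A potential lives on [-1, 1]; only the values of h there matter. *)
Definition potential h : Prop :=
  [/\ {within `[-1, 1], continuous h},
      forall t, -1 <= t <= 1 -> h t != -oo%E
    & forall t, -1 <= t < 1 -> h t \is a fin_num].

(* Derivative relative to D, hence one-sided at an endpoint of D. *)
Definition quotient_within D f t : set_system R :=
  (fun u => (f u - f t) / (u - t)) @ within D (dnbhs t).

Definition derivable_within D f t : Prop := cvg (quotient_within D f t).

Definition derive_within D f t : R := lim (quotient_within D f t).

Definition derive_n_within D k f : R -> R := iter k (derive_within D) f.

Definition nth_derivative_ge0 h k : Prop :=
  let D : set R := `[-1, 1[%classic in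
  (forall j t, (j < k)%N -> -1 <= t < 1 ->
     derivable_within D (derive_n_within D j (fine \o h)) t) /\
  (forall t, -1 <= t < 1 -> 0 <= derive_n_within D k (fine \o h) t).

End Potentials.

Section Orthogonal.
Variable R : realType.
Implicit Types (n k : nat) (a b : R) (f p q : {poly R}).

(* Euler's Gamma function, used for positive arguments only. *)
Definition Gamma (z : R) : R :=
  \int[lebesgue_measure]_(t in `]0, +oo[) (t `^ (z - 1) * expR (- t)).

Definition gegenbauer_const n : R :=
  Gamma (n%:R / 2) / (Num.sqrt pi * Gamma ((n%:R - 1) / 2)).

(* Also the zeroth Gegenbauer coefficient f_0 of f. *)
Definition mu_int n f : R :=
  \int[lebesgue_measure]_(t in `[-1, 1])
    (gegenbauer_const n * (1 - t ^+ 2) `^ ((n%:R - 3) / 2) * f.[t]).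

Definition is_orthogonal_poly (I : {poly R} -> R) k p : Prop :=
  size p = k.+1 /\ (forall q, (size q <= k)%N -> I (p * q) = 0).

(* xget picks the polynomial determined by the conditions. *)
Definition gegenbauer n k : {poly R} :=
  xget 0 [set p | is_orthogonal_poly (mu_int n) k p /\ p.[1] = 1].

Definition jacobi_int a b f : R :=
  \int[lebesgue_measure]_(t in `[-1, 1])
    ((1 - t) `^ a * (1 + t) `^ b * f.[t]).

(* Usual normalization: the value at 1 is the binomial (k + a choose k). *)
Definition jacobi a b k : {poly R} :=
  xget 0 [set p | is_orthogonal_poly (jacobi_int a b) k p /\
                  p.[1] = \prod_(i < k) ((a + i.+1%:R) / i.+1%:R)].

End Orthogonal.

Definition weighted_design (R : realType) (n N : nat)
    (x : 'I_N -> 'rV[R]_n) (w : 'I_N -> R) (tau : nat) : Prop :=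
  forall r, (1 <= r <= tau)%N ->
    \sum_(i < N) \sum_(j < N)
      w i * w j * (gegenbauer R n r).[dotp (x i) (x j)] = 0.

(* For q >= 1 these are the unique l >= 1 and e in {0, 1} such that
   q = 2 * l - 1 + e; booleans are read as 0 and 1. *)
Definition lev_l (q : nat) : nat := uphalf q.
Definition lev_e (q : nat) : bool := ~~ odd q.

Lemma lev_lE (l : nat) (e : bool) : (1 <= l)%N -> lev_l (2 * l - 1 + e) = l.
Proof.
case: l => // l _; rewrite /lev_l mul2n doubleS subn1.
by case: e; rewrite ?addn1 ?addn0 /= ?uphalf_double ?doubleK.
Qed.

Lemma lev_eE (l : nat) (e : bool) : (1 <= l)%N -> lev_e (2 * l - 1 + e) = e.
Proof.
case: l => // l _.
by rewrite /lev_e mul2n doubleS subn1 oddD /= odd_double negbK oddb.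
Qed.

Definition lev_D (n q : nat) : nat :=
  let l := lev_l q in let e := lev_e q in
  'C(n + l + e - 2, n - 1) + 'C(n + l - 2, n - 1).

Section Levenshtein.
Variables (R : realType) (n q : nat).
Let l := lev_l q.
Let e := lev_e q.

(* t_k^{a,b}; the value -1 for k = 0 is used only with a = b = 1. *)
Definition jacobi_top (a b : bool) (k : nat) : R :=
  if k is 0 then -1
  else last 0 (rootsR (jacobi (a%:R + (n%:R - 3) / 2 : R)
                              (b%:R + (n%:R - 3) / 2) k)).

Definition lev_interval : set R :=
  `[jacobi_top true (~~ e) (l - 1 + e), jacobi_top true e l].

Definition lev_L (s : R) : R :=
  let P k := (gegenbauer R n k).[s] in
  'C(l + n + e - 3, n - 2)%:R *
  ((2 * l + n + 2 * e - 3)%:R / (n - 1)%:R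
   - ((1 + s) ^+ e * (P (l - 1 + e)%N - P (l + e)%N))
     / ((1 - s) * (e%:R * P l + P (l + e)%N))).

(* The polynomial t |-> K_{l-1}(t, s): the element of the space of polynomials
   of degree at most l - 1 representing evaluation at s. *)
Definition lev_kernel (s : R) : {poly R} :=
  xget 0 [set K : {poly R} | (size K <= l)%N /\
    forall p : {poly R}, (size p <= l)%N ->
      mu_int n ((1 - 'X) * (1 + 'X) ^+ e * (K * p)) = p.[s]].

Definition lev_poly (s : R) : {poly R} :=
  let f := (1 + 'X) ^+ e * ('X - s%:P) * lev_kernel s ^+ 2 in
  (lead_coef f)^-1 *: f.

(* rootsR lists the distinct roots in increasing order. *)
Definition lev_node (s : R) (i : nat) : R := (rootsR (lev_poly s))`_i.

Definition lev_weight (s : R) (i : nat) : R :=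
  let li : {poly R} := \prod_(j < l + e | j != i :> nat) ('X - (lev_node s j)%:P) in
  (mu_int n li - li.[1] / lev_L s) / li.[lev_node s i].

Definition lev_multiset (s : R) : seq R :=
  let twice (r : seq nat) := [seq lev_node s i | i <- r ++ r] in
  if e then lev_node s 0 :: twice (iota 1 (l - 1)) ++ [:: lev_node s l]
  else twice (iota 0 (l - 1)) ++ [:: lev_node s (l - 1)].

Definition lev_interpolant (h : R -> \bar R) (s : R) : {poly R} :=
  let T := lev_multiset s in
  xget 0 [set g : {poly R} | [/\ (size g <= q)%N,
    forall t, t \in T -> g.[t] = fine (h t)
  & forall t, (2 <= count_mem t T)%N ->
      (g^`()).[t] = derive_within `[-1, 1[%classic (fine \o h) t]].

End Levenshtein.

(* Main.v *)
(* The interpolant g_T agrees with h on the nodes to the orders in T, and the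
   node polynomial of T is nonpositive on [-1, s]; by iterated Rolle and
   h^(tau) >= 0 this gives h <= g_T on [-1, s], which contains all the inner
   products of distinct code points. Hence E_h(C, W) is at most the full double
   sum of g_T minus its diagonal g_T(1) / N_W, and the design property turns
   the double sum into the integral of g_T, which the Levenshtein quadrature
   evaluates.

   The quadrature itself is obtained algebraically. Writing U_k for the kernel
   (P_k - P_(k+1)) / (1 - t), which represents p |-> p(1) up to the factor
   mu(U_k), an explicit combination of U_(l-1+e) and of P_l, P_(l+e) vanishes at
   s and is orthogonal to low degrees for (1 - t)(1 + t)^e dmu; it is therefore
   (1 + t)^e (t - s) K(t, s), and its value at 1 against its integral is
   L_q(n, s). The position of the nodes only uses that s is at least the left
   end of I_q: by Gauss quadrature this says that
   v |-> J((1 + t)(s - t) v^2) is nonnegative in low degree, where J is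
   integration against (1 - t)(1 + t)^e dmu. *)
Require Import Defs.
From HB Require Import structures.
From mathcomp Require Import all_boot all_order all_algebra.
From mathcomp Require Import ring lra zify.
From mathcomp Require Import polyrcf.
From mathcomp Require Import all_classical all_reals all_analysis.
From mathcomp Require Import measurable_realfun.
Set Implicit Arguments.
Unset Strict Implicit.
Unset Printing Implicit Defensive.
Import Order.TTheory GRing.Theory Num.Theory.
Import numFieldNormedType.Exports.
Local Open Scope classical_set_scope.
Local Open Scope ring_scope.

(** * Improper integrals and the Gamma function *)

(** Analysis enters through three facts about [mu_int n]: positivity on nonzero polynomials that are
    nonnegative on [-1, 1], mass 1, and mu((1 - t^2) p') = (n - 1) mu(t p). Parity, the differential
    equation, the recurrence and the kernels follow from these for an abstract linear form, without
    explicit formulas for the polynomials. Mass 1 is where the Gamma factors matter: the constant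
    and the integral obey inverse recursions from n to n + 2, started at n = 2 and n = 3. The strict
    bound D(n, q) < N_q excludes two degenerate cases. If the denominator of L_q vanishes at s, the
    combination that carries the quadrature has integral 0 and the weight at 1 cannot be read off
    it. If e = 1 and U_l(s) = 0, a second node may fall on -1. In both cases L_q(n, s) would reduce
    to a binomial times U_(l-1+e)(1), which does not exceed D(n, q). *)

Section ImproperIntegral.
Variable R : realType.
Notation mu := (@lebesgue_measure R).

(** The fundamental theorem on each [a k, b k], then monotone convergence. Splitting the derivative
    of [F] into two nonnegative parts keeps the identity meaningful in the extended reals, with no
    integrability presupposed: [g = 0] evaluates an integral, other [g] integrate by parts. *)
Lemma integral_exhaustion (a b : nat -> R) (E : set R) (f g F : R -> R) (A B : R) :
  (forall k, a k < b k) ->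
  (forall k, a k.+1 <= a k) -> (forall k, b k <= b k.+1) ->
  \bigcup_k `[a k, b k]%classic = E ->
  (forall x, E x -> 0 <= f x) -> (forall x, E x -> 0 <= g x) ->
  (forall x, E x -> {for x, continuous f}) ->
  (forall x, E x -> {for x, continuous g}) ->
  (forall x, E x -> is_derive x 1 F (f x - g x)) ->
  F (a k) @[k --> \oo] --> A -> F (b k) @[k --> \oo] --> B ->
  (\int[mu]_(x in E) (f x)%:E = \int[mu]_(x in E) (g x)%:E + (B - A)%:E)%E.
Proof.
move=> ab decra incrb EE f0 g0 cf cg dF FA FB.
have subE k x : `[a k, b k]%classic x -> E x by rewrite -EE; exists k.
have cin (u : R -> R) k : (forall x, E x -> {for x, continuous u}) ->
    {within `[a k, b k], continuous u}.
  move=> cu; apply: continuous_in_subspaceT => x; rewrite inE => xab.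
  by apply: cu; exact: subE xab.
have intE k : (\int[mu]_(x in `[a k, b k]) (f x)%:E =
    \int[mu]_(x in `[a k, b k]) (g x)%:E + (F (b k) - F (a k))%:E)%E.
  have ig : mu.-integrable `[a k, b k] (EFin \o g).
    by apply: continuous_compact_integrable; [exact: segment_compact|exact: cin].
  have fi : mu.-integrable `[a k, b k] (EFin \o f).
    by apply: continuous_compact_integrable; [exact: segment_compact|exact: cin].
  have cF x : E x -> {for x, continuous F}.
    move=> Ex; apply/differentiable_continuous/derivable1_diffP.
    by have := dF x Ex; case.
  have := @continuous_FTC2 R (fun x => f x - g x) F (a k) (b k) (ab k).
  rewrite -EFinB => <-; first 1 last.
  - by apply: cin => x Ex; apply: cvgB; [exact: cf|exact: cg].
  - split.
    + move=> x xab; have Ex : E x by apply: (subE k); exact: subset_itv_oo_cc.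
      by have := dF x Ex; case.
    + apply: cvg_at_right_filter; apply: cF; apply: (subE k).
      by rewrite /= in_itv/= lexx ltW.
    + apply: cvg_at_left_filter; apply: cF; apply: (subE k).
      by rewrite /= in_itv/= lexx ltW.
  - move=> x xab; have Ex : E x by apply: (subE k); exact: subset_itv_oo_cc.
    by rewrite derive1E; have := dF x Ex; case.
  under [X in (_ + X)%E]eq_integral do rewrite EFinB.
  rewrite integralB//= addeCA subee ?adde0//.
  exact: integrable_fin_num.
have ndE : nondecreasing_seq (fun k => `[a k, b k]%classic).
  apply/nondecreasing_seqP => k; rewrite subsetEset => x /=.
  rewrite !in_itv/= => /andP[ax xb].
  by rewrite (le_trans (decra k))//= (le_trans _ (incrb k)).
have lim (u : R -> R) : (forall x, E x -> 0 <= u x) ->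
    (forall x, E x -> {for x, continuous u}) ->
    (\int[mu]_(x in `[a k, b k]) (u x)%:E)%E @[k --> \oo] -->
    (\int[mu]_(x in E) (u x)%:E)%E.
  move=> u0 cu; rewrite -EE; apply: ge0_nondecreasing_set_cvg_integral => //.
  - move=> k; apply/measurable_EFinP.
    by apply: subspace_continuous_measurable_fun => //; exact: cin.
  - by move=> k x xk; rewrite lee_fin; apply: u0; exact: subE xk.
have /cvg_lim <-// := lim f f0 cf.
apply/cvg_lim => //; under eq_fun do rewrite intE.
apply: cvgeD; last 1 first.
- by apply: cvg_EFin; [exact: nearW|exact: cvgB].
- by rewrite fin_num_adde_defl.
- exact: lim.
Qed.

End ImproperIntegral.

Section GammaFunction.
Variable R : realType.
Notation mu := (@lebesgue_measure R).

Lemma integral_0y (f g F : R -> R) (A B : R) :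
  (forall x : R, 0 < x -> 0 <= f x) -> (forall x, 0 < x -> 0 <= g x) ->
  (forall x : R, 0 < x -> {for x, continuous f}) ->
  (forall x : R, 0 < x -> {for x, continuous g}) ->
  (forall x : R, 0 < x -> is_derive x 1 F (f x - g x)) ->
  F x @[x --> 0^'+] --> A -> F x @[x --> +oo] --> B ->
  (\int[mu]_(x in `]0%R, +oo[) (f x)%:E =
   \int[mu]_(x in `]0%R, +oo[) (g x)%:E + (B - A)%:E)%E.
Proof.
move=> f0 g0 cf cg dF FA FB.
have E0 x : `]0, +oo[%classic x -> 0 < x by rewrite /= in_itv/= andbT.
apply: (@integral_exhaustion _ (fun k => k.+1%:R^-1) (fun k => k.+2%:R) _ f g F).
- by move=> k; rewrite (le_lt_trans (y := 1)) ?invf_le1 ?ler1n ?ltr1n.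
- by move=> k; rewrite lef_pV2 ?posrE ?ltr0n// ler_nat.
- by move=> k; rewrite ler_nat.
- apply/seteqP; split => x /=.
    move=> [k _] /=; rewrite !in_itv/= andbT => /andP[kx _].
    by rewrite (lt_le_trans _ kx)// invr_gt0 ltr0n.
  rewrite in_itv/= andbT => x0.
  have xi0 : 0 <= Num.max x x^-1 by rewrite le_max ltW.
  (* For this k, both x and 1 / x are below k + 1. *)
  exists (Num.truncn (Num.max x x^-1)) => //=.
  have := truncnS_gt (Num.max x x^-1).
  set k := Num.truncn _; rewrite gt_max => /andP[xk xVk].
  rewrite in_itv/= -[x in _ <= x <= _]invrK lef_pV2 ?posrE ?invr_gt0 ?ltr0n//.
  by rewrite ltW//= invrK (le_trans (ltW xk))// ler_nat.
- by move=> x /E0; exact: f0.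
- by move=> x /E0; exact: g0.
- by move=> x /E0; exact: cf.
- by move=> x /E0; exact: cg.
- by move=> x /E0; exact: dF.
- have /cvg_at_rightP := FA; apply; split; first by move=> k; rewrite invr_gt0.
  exact: cvg_harmonic.
- have /cvg_pinftyP := FB; apply.
  have /= := cvg_comp (fun n => n.+2) (GRing.natmul (1 : R)) _ (@cvgr_idn R).
  by apply; rewrite (_ : (fun n => n.+2) = addn 2) //; exact: cvg_addnl.
Qed.

Lemma continuous_powR (a x : R) : 0 < x -> {for x, continuous (@powR R ^~ a)}.
Proof.
move=> x0; apply/differentiable_continuous/derivable1_diffP.
by have [] := is_derive1_powR a x0.
Qed.

Definition gamma_density (z t : R) : R := t `^ (z - 1) * expR (- t).

Lemma gamma_density_ge0 z t : 0 <= gamma_density z t.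
Proof. by rewrite mulr_ge0 ?powR_ge0 ?expR_ge0. Qed.

Lemma gamma_density_continuous z t : 0 < t ->
  {for t, continuous (gamma_density z)}.
Proof.
move=> t0; apply: cvgM; first exact: continuous_powR.
apply: (@continuous_comp _ _ _ (fun x : R => - x) expR); last exact: continuous_expR.
exact: oppr_continuous.
Qed.

Lemma cvgN_expR_0 : expR (- t) @[t --> (0 : R)^'+] --> (1 : R).
Proof.
rewrite -[X in _ --> X](@expR0 R) -{2}oppr0.
apply: cvg_at_right_filter.
apply: (@continuous_comp _ _ _ (fun x : R => - x) expR); last exact: continuous_expR.
exact: oppr_continuous.
Qed.

(** Half of the exponential absorbs the power: 1 + u <= exp u at u = t / (2 z) gives t exp(- t / (2
    z)) <= 2 z, which is then raised to the power z. *)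
Lemma powR_expR_bound (z t : R) : 0 < z -> 0 <= t ->
  t `^ z * expR (- t) <= (2 * z) `^ z * expR (- (t / 2)).
Proof.
move=> z0 t0.
have -> : - t = - (t / 2) + - (t / 2) by field.
rewrite expRD mulrA ler_wpM2r ?expR_ge0//.
have -> : expR (- (t / 2)) = expR (- (t / (2 * z))) `^ z.
  by rewrite -expRM; congr expR; field; rewrite gt_eqF.
rewrite -powRM ?expR_ge0//.
apply: ge0_ler_powR.
- exact: ltW.
- by rewrite nnegrE mulr_ge0 ?expR_ge0.
- by rewrite nnegrE mulr_ge0 ?ltW.
rewrite expRN ler_pdivrMr ?expR_gt0// -ler_pdivrMl ?mulr_gt0// mulrC.
by rewrite (le_trans _ (expR_ge1Dx _))// lerDr.
Qed.

Lemma cvg_powR_expR (z : R) : 0 < z ->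
  (t `^ z * expR (- t)) @[t --> +oo] --> (0 : R).
Proof.
move=> z0.
apply: (@squeeze_cvgr _ _ _ _ (fun=> 0) (fun t => (2 * z) `^ z * expR (- (t / 2)))).
- near=> t; rewrite mulr_ge0 ?powR_ge0 ?expR_ge0//= powR_expR_bound//.
- exact: cvg_cst.
- rewrite -[X in _ --> X](mulr0 ((2 * z) `^ z)).
  apply: cvgM; first exact: cvg_cst.
  apply: (@cvg_comp _ _ _ (fun t : R => t / 2) (fun t => expR (- t)) _ (pinfty_nbhs R)).
    by apply: gt0_cvgMly; [rewrite invr_gt0|exact: cvg_id].
  exact: cvgr_expR.
Unshelve. all: by end_near. Qed.

(** Kept in the extended reals: [Gamma] is [fine] of it, and [fine] sends an infinite integral to 0,
    so finiteness must be known before [Gamma] is evaluated. *)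
Definition Egamma (z : R) : \bar R :=
  (\int[mu]_(t in `]0%R, +oo[) (gamma_density z t)%:E)%E.

Lemma GammaE z : Gamma z = fine (Egamma z).
Proof. by []. Qed.

Lemma EgammaS z : 0 < z -> Egamma (z + 1) = (z%:E * Egamma z)%E.
Proof.
move=> z0.
have -> : (z%:E * Egamma z = 
    \int[mu]_(t in `]0%R, +oo[) (z * gamma_density z t)%:E)%E.
  under [RHS]eq_integral do rewrite EFinM.
  rewrite ge0_integralZl//=; last by rewrite lee_fin ltW.
    apply/measurable_EFinP; apply: open_continuous_measurable_fun => //.
    by move=> x; rewrite inE/= in_itv/= andbT; exact: gamma_density_continuous.
  by move=> x _; rewrite lee_fin gamma_density_ge0.
rewrite /Egamma.
rewrite -[RHS]adde0 [X in (_ + X)%E](_ : _ = (0 - 0)%:E :> \bar R); last by rewrite subrr.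
apply: (@integral_0y _ _ (fun t => - (t `^ z * expR (- t)))).
- by move=> *; exact: gamma_density_ge0.
- by move=> *; rewrite mulr_ge0 ?gamma_density_ge0// ltW.
- by move=> *; exact: gamma_density_continuous.
- move=> x x0; apply: cvgM; first exact: cvg_cst.
  exact: gamma_density_continuous.
- move=> x x0; rewrite /gamma_density addrK.
  have dp := is_derive1_powR z x0.
  have de : is_derive x 1 (fun t : R => expR (- t)) (expR (- x) * -1).
    exact: (@is_derive1_comp _ expR (fun t => - t)).
  apply: (is_derive_eq (is_deriveN (is_deriveM dp de))).
  rewrite /GRing.scale/=; ring.
- rewrite -[X in _ --> X]oppr0; apply: cvgN.
  rewrite -[X in _ --> X](mul0r 1).
  by apply: cvgM; [exact: powR_cvg0|exact: cvgN_expR_0].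
- by rewrite -[X in _ --> X]oppr0; apply: cvgN; exact: cvg_powR_expR.
Qed.

Lemma Egamma1 : Egamma 1 = 1%E.
Proof.
rewrite -[RHS]add0e -(integral0 mu `]0, +oo[).
rewrite (_ : 1%E = (0 - (-1))%:E :> \bar R); last by rewrite opprK add0r.
apply: (@integral_0y _ (fun=> 0) (fun t => - expR (- t))).
- by move=> *; exact: gamma_density_ge0.
- by [].
- by move=> *; exact: gamma_density_continuous.
- by move=> *; exact: cvg_cst.
- move=> x x0; rewrite /gamma_density subrr powRr0 mul1r subr0.
  have de : is_derive x 1 (fun t : R => expR (- t)) (expR (- x) * -1).
    exact: (@is_derive1_comp _ expR (fun t => - t)).
  by apply: (is_derive_eq (is_deriveN de)); ring.
- by apply: cvgN; exact: cvgN_expR_0.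
- by rewrite -[X in _ --> X]oppr0; apply: cvgN; exact: cvgr_expR.
Qed.

End GammaFunction.

(** * Gamma at half-integers and the normalizing constant *)

Section GammaHalf.
Variable R : realType.
Notation mu := (@lebesgue_measure R).
Notation gint := (@gauss_integral_proof.integral0_gauss R).

Lemma cvgy_gauss_integral : gint x @[x --> +oo] --> Num.sqrt pi / 2.
Proof.
have -> : Num.sqrt pi / 2 = Num.sqrt (pi / 4) :> R.
  rewrite sqrtrM ?pi_ge0// sqrtrV// (_ : 4 = 2 ^+ 2); last by rewrite expr2 -natrM.
  by rewrite sqrtr_sqr ger0_norm.
have : Num.sqrt (gint x ^+ 2) @[x --> +oo] --> Num.sqrt (pi / 4 : R).
  apply: continuous_cvg; first exact: sqrt_continuous.
  exact: gauss_integral_proof.cvg_integral0_gauss_sqr.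
apply: cvg_trans; apply: near_eq_cvg; near=> x.
by rewrite sqrtr_sqr ger0_norm// gauss_integral_proof.integral0_gauss_ge0.
Unshelve. all: by end_near. Qed.

Lemma gauss_integrable (a b : R) : mu.-integrable `[a, b] (EFin \o gauss_fun).
Proof.
apply: continuous_compact_integrable; first exact: segment_compact.
by apply: continuous_subspaceT; exact: continuous_gauss_fun.
Qed.

Lemma is_derive_gauss_integral (x : R) : 0 < x -> is_derive x 1 gint (gauss_fun x).
Proof.
move=> x0; have xx1 : x < x + 1 by rewrite ltrDl.
have [] := continuous_FTC1_closed xx1 (gauss_integrable 0 (x + 1)) x0
  (@continuous_gauss_fun _ _).
by rewrite derive1E => d e; apply: DeriveDef.
Qed.

(** The substitution t = u^2: with [gint] x the integral of exp(- u^2) over [0, x], an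
    antiderivative of t^(-1/2) exp(- t) is 2 [gint] (sqrt t). *)
Lemma Egamma_half : Egamma (2^-1) = (Num.sqrt (pi : R))%:E.
Proof.
rewrite -[RHS]add0e -(integral0 mu `]0, +oo[).
rewrite (_ : Num.sqrt pi = 2 * (Num.sqrt pi / 2) - 2 * 0); last by field.
apply: (@integral_0y _ _ (fun=> 0) (fun t => 2 * gint (Num.sqrt t))).
- by move=> *; exact: gamma_density_ge0.
- by [].
- by move=> *; exact: gamma_density_continuous.
- by move=> *; exact: cvg_cst.
- move=> x x0; rewrite /gamma_density subr0.
  have s0 : 0 < Num.sqrt x by rewrite sqrtr_gt0.
  have dc := is_derive1_comp (is_derive_gauss_integral s0) (is_derive1_sqrt x0).
  apply: (is_derive_eq (is_deriveZ 2 dc)).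
  rewrite /GRing.scale/= /gauss_fun sqr_sqrtr ?(ltW x0)//.
  rewrite (_ : 2^-1 - 1 = - 2^-1); last by field.
  rewrite powRN powR12_sqrt ?(ltW x0)//; field.
  by rewrite gt_eqF.
- apply: cvgM; first exact: cvg_cst.
  apply: cvg_at_right_filter.
  apply: (@cvg_comp _ _ _ Num.sqrt gint _ (nbhs (0 : R))).
    by have := @sqrt_continuous R 0; rewrite /continuous_at sqrtr0.
  by apply: (parameterized_integral_cvg_left (@ltr01 R)); exact: gauss_integrable.
- apply: cvgM; first exact: cvg_cst.
  apply: (@cvg_comp _ _ _ Num.sqrt gint _ (pinfty_nbhs R)); last exact: cvgy_gauss_integral.
  apply/cvgryPge => A; near=> t.
  have A0 : 0 <= Num.max A 0 by rewrite le_max lexx orbT.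
  rewrite (le_trans (y := Num.max A 0)) ?le_max ?lexx//.
  rewrite -[leLHS]ger0_norm// -sqrtr_sqr ler_wsqrtr//.
Unshelve. all: by end_near. Qed.

Lemma Egamma_fin_gt0 (k : nat) :
  exists2 r : R, 0 < r & Egamma (k.+1%:R / 2) = r%:E.
Proof.
have [m] := ubnP k; elim: m k => // m IH [|[|k]] /ltnSE km.
- exists (Num.sqrt pi); first by rewrite sqrtr_gt0 pi_gt0.
  by rewrite mul1r Egamma_half.
- by exists 1 => //; rewrite divff// Egamma1.
- have [|r r0 rE] := IH k; first exact: leq_trans km.
  exists (k.+1%:R / 2 * r); first by rewrite !mulr_gt0 ?invr_gt0 ?ltr0n.
  rewrite (_ : k.+3%:R / 2 = k.+1%:R / 2 + 1); last by rewrite -[k.+3]addn2 natrD; field.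
  by rewrite EgammaS ?divr_gt0 ?ltr0n// rE -EFinM.
Qed.

Lemma Gamma_gt0 (k : nat) : 0 < Gamma (k.+1%:R / 2 : R).
Proof. by have [r r0 E] := Egamma_fin_gt0 k; rewrite GammaE E. Qed.

Lemma GammaS (k : nat) :
  Gamma (k.+3%:R / 2 : R) = k.+1%:R / 2 * Gamma (k.+1%:R / 2).
Proof.
have [r r0 E] := Egamma_fin_gt0 k.
rewrite (_ : k.+3%:R / 2 = k.+1%:R / 2 + 1); last by rewrite -[k.+3]addn2 natrD; field.
by rewrite !GammaE EgammaS ?divr_gt0 ?ltr0n// E -EFinM.
Qed.

Lemma Gamma1 : Gamma (1 : R) = 1.
Proof. by rewrite GammaE Egamma1. Qed.

Lemma Gamma_half : Gamma (2^-1 : R) = Num.sqrt pi.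
Proof. by rewrite GammaE Egamma_half. Qed.

Lemma gegenbauer_const_gt0 (n : nat) : (2 <= n)%N -> 0 < gegenbauer_const R n.
Proof.
case: n => [|[|n]] // _; rewrite /gegenbauer_const.
rewrite (_ : n.+2%:R - 1 = n.+1%:R :> R); last by rewrite -[n.+2]addn1 natrD addrK.
by rewrite divr_gt0 ?mulr_gt0 ?Gamma_gt0// sqrtr_gt0 pi_gt0.
Qed.

Lemma gegenbauer_const2 : gegenbauer_const R 2 = pi^-1.
Proof.
rewrite /gegenbauer_const divff// Gamma1 (_ : 2 - 1 = 1 :> R); last by ring.
by rewrite !mul1r Gamma_half -expr2 sqr_sqrtr ?pi_ge0.
Qed.

Lemma gegenbauer_const3 : gegenbauer_const R 3 = 2^-1.
Proof.
rewrite /gegenbauer_const (_ : 3 - 1 = 2 :> R); last by ring.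
rewrite divff// Gamma1 (GammaS 0) !mul1r Gamma_half; field.
by rewrite gt_eqF// sqrtr_gt0 pi_gt0.
Qed.

(** The factor is inverse to the one in [sphere_intSS], so the total mass is the same for n and n +
    2. *)
Lemma gegenbauer_constSS (n : nat) : (2 <= n)%N ->
  gegenbauer_const R n.+2 = n%:R / (n%:R - 1) * gegenbauer_const R n.
Proof.
case: n => [|[|n]] // _; rewrite /gegenbauer_const.
rewrite (_ : n.+2%:R - 1 = n.+1%:R :> R); last by rewrite -[n.+2]addn1 natrD addrK.
rewrite (_ : n.+4%:R - 1 = n.+3%:R :> R); last by rewrite -[n.+4]addn1 natrD addrK.
rewrite !GammaS; field.
have := @Gamma_gt0 n; have := pi_gt0 R.
rewrite -(sqrtr_gt0 pi) => p g.
by rewrite ?(gt_eqF p) ?(gt_eqF g) ?andbT/= (_ : 1 + n%:R = n.+1%:R) ?pnatr_eq0// -natr1 addrC.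
Qed.

End GammaHalf.

(** * The Gegenbauer functional *)

Section GegenbauerMeasure.
Variable R : realType.
Notation mu := (@lebesgue_measure R).

Lemma integral_N11 (f g F : R -> R) (A B : R) :
  (forall x : R, -1 < x < 1 -> 0 <= f x) ->
  (forall x : R, -1 < x < 1 -> 0 <= g x) ->
  (forall x : R, -1 < x < 1 -> {for x, continuous f}) ->
  (forall x : R, -1 < x < 1 -> {for x, continuous g}) ->
  (forall x : R, -1 < x < 1 -> is_derive x 1 F (f x - g x)) ->
  F x @[x --> (-1)^'+] --> A -> F x @[x --> 1^'-] --> B ->
  (\int[mu]_(x in `](-1)%R, 1%R[) (f x)%:E =
   \int[mu]_(x in `](-1)%R, 1%R[) (g x)%:E + (B - A)%:E)%E.
Proof.
move=> f0 g0 cf cg dF FA FB.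
have E0 (x : R) : `](-1 : R), 1[%classic x -> -1 < x < 1 by rewrite /= in_itv/=.
have h1 (k : nat) : k.+2%:R^-1 < 1 :> R by rewrite invf_lt1 ?ltr0n// ltr1n.
have h0 (k : nat) : 0 < k.+2%:R^-1 :> R by rewrite invr_gt0 ltr0n.
have hS (k : nat) : k.+3%:R^-1 <= k.+2%:R^-1 :> R.
  by rewrite lef_pV2 ?posrE ?ltr0n// ler_nat.
have hc : k.+2%:R^-1 @[k --> \oo] --> (0 : R).
  have := @cvg_harmonic R; rewrite -(cvg_shiftS (fun k : nat => k.+1%:R^-1 : R)).
  exact.
apply: (@integral_exhaustion _ (fun k => -1 + k.+2%:R^-1)
  (fun k => 1 - k.+2%:R^-1) _ f g F).
- by move=> k; have := h1 k; move: (_^-1) => c; lra.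
- by move=> k; rewrite lerD2l.
- by move=> k; rewrite lerD2l lerN2.
- apply/seteqP; split => x /=.
    move=> [k _] /=; rewrite !in_itv/= => /andP[kx xk].
    have := h0 k; move: (_^-1) kx xk => c kx xk c0; apply/andP; split; lra.
  rewrite in_itv/= => /andP[x0 x1].
  have m0 : 0 < Num.min (1 - x) (1 + x) by rewrite lt_min; apply/andP; split; lra.
  exists (Num.truncn (Num.min (1 - x) (1 + x))^-1) => //=.
  have := truncnS_gt (Num.min (1 - x) (1 + x))^-1.
  set k := Num.truncn _ => xk.
  have : k.+2%:R^-1 <= Num.min (1 - x) (1 + x).
    rewrite -[leRHS]invrK lef_pV2 ?posrE ?ltr0n ?invr_gt0//.
    by rewrite (le_trans (ltW xk))// ler_nat.
  rewrite le_min in_itv/=; move: (_^-1) => c /andP[? ?]; apply/andP; split; lra.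
- by move=> x xE; apply: f0; exact: E0.
- by move=> x xE; apply: g0; exact: E0.
- by move=> x xE; apply: cf; exact: E0.
- by move=> x xE; apply: cg; exact: E0.
- have /cvg_at_rightP := FA; apply; split.
    by move=> k; rewrite ltrDl.
  by rewrite -[X in _ --> X]addr0; apply: cvgD => //; exact: cvg_cst.
- have /cvg_at_leftP := FB; apply; split.
    by move=> k; rewrite ltrBlDr ltrDl.
  by rewrite -[X in _ --> X]subr0; apply: cvgB => //; exact: cvg_cst.
Qed.

(** Monotonicity of the sine: asin x < pi / 2 - d would force x < sin (pi / 2 - d) < 1. The cap d <=
    pi / 2 keeps pi / 2 - d where the sine increases. *)
Lemma cvg_asin1 : asin x @[x --> 1^'-] --> (pi / 2 : R).
Proof.
apply/cvgrPdist_le => e e0.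
pose d : R := Num.min e (pi / 2).
have p0 := pi_gt0 R.
have d0 : 0 < d by rewrite lt_min e0 divr_gt0.
have dp : d <= pi / 2 by rewrite ge_min lexx orbT.
have de : d <= e by rewrite ge_min lexx.
have s1 : sin (pi / 2 - d) < 1.
  rewrite -[ltRHS](@sin_pihalf R) ltr_sin ?in_itv/= ?lexx ?andbT; try lra.
near=> x.
have x1 : -1 <= x <= 1.
  apply/andP; split; near: x.
    by apply: nbhs_left_ge; lra.
  exact: nbhs_left_le.
have l := asin_lepi2 x1; have g := asin_geNpi2 x1.
rewrite ger0_norm ?subr_ge0// lerBlDr -lerBlDl (le_trans (y := pi / 2 - d)) ?lerD2l ?lerN2//.
rewrite leNgt; apply/negP => ax.
have : sin (asin x) < sin (pi / 2 - d).
  rewrite ltr_sin// in_itv/=; first by rewrite l g.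
  by apply/andP; split; lra.
rewrite asinK ?in_itv//= ltNge => /negP; apply; near: x.
exact: nbhs_left_ge.
Unshelve. all: by end_near. Qed.

Lemma cvg_asinN1 : asin x @[x --> (-1)^'+] --> (- (pi / 2) : R).
Proof.
apply/cvgrPdist_le => e e0.
pose d : R := Num.min e (pi / 2).
have p0 := pi_gt0 R.
have d0 : 0 < d by rewrite lt_min e0 divr_gt0.
have dp : d <= pi / 2 by rewrite ge_min lexx orbT.
have de : d <= e by rewrite ge_min lexx.
have s1 : -1 < sin (- (pi / 2) + d).
  have sN : sin (- (pi / 2)) = -1 :> R by rewrite sinN sin_pihalf.
  by rewrite -sN ltr_sin ?in_itv/= ?lexx/=; lra.
near=> x.
have x1 : -1 <= x <= 1.
  apply/andP; split; near: x.
    exact: nbhs_right_ge.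
  by apply: nbhs_right_le; lra.
have l := asin_lepi2 x1; have g := asin_geNpi2 x1.
rewrite distrC ger0_norm ?subr_ge0// opprK -lerBrDr.
rewrite (le_trans (y := - (pi / 2) + d)) //; last by lra.
rewrite leNgt; apply/negP => ax.
have : sin (- (pi / 2) + d) < sin (asin x).
  rewrite ltr_sin// in_itv/=; last by rewrite l g.
  by apply/andP; split; lra.
rewrite asinK ?in_itv//= ltNge => /negP; apply; near: x.
exact: nbhs_right_le.
Unshelve. all: by end_near. Qed.

End GegenbauerMeasure.

(** * Integration of polynomials against the sphere weight *)

Section GegenbauerFunctional.
Variable R : realType.
Notation mu := (@lebesgue_measure R).
Notation Ioo := `](-1 : R)%R, 1%R[%classic.
Implicit Types (p q : {poly R}) (n : nat).

(* On ]-1, 1[ this is (1 - t^2)^((n - 3) / 2); the square root makes the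
   numerator continuous up to the endpoints, also for n = 2. *)
Definition sphere_weight n (t : R) : R := Num.sqrt (1 - t ^+ 2) ^+ n.-1 / (1 - t ^+ 2).

Lemma onem_sqr_gt0 (t : R) : -1 < t < 1 -> 0 < 1 - t ^+ 2.
Proof. by move=> /andP[? ?]; nra. Qed.

Lemma sphere_weightE n (t : R) : (2 <= n)%N -> -1 < t < 1 ->
  (1 - t ^+ 2) `^ ((n%:R - 3) / 2) = sphere_weight n t.
Proof.
case: n => [|n] // _ /onem_sqr_gt0 t0; rewrite /sphere_weight.
rewrite (_ : (n.+1%:R - 3) / 2 = 2^-1 * n%:R - 1); last by rewrite -natr1; field.
rewrite powRB; last by rewrite (gt_eqF t0) implybT.
by rewrite powRr1 ?ltW// powRrM powR12_sqrt ?ltW// powR_mulrn ?sqrtr_ge0.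
Qed.

Lemma sphere_weight_gt0 n (t : R) : -1 < t < 1 -> 0 < sphere_weight n t.
Proof. by move=> /onem_sqr_gt0 t0; rewrite divr_gt0// exprn_gt0// sqrtr_gt0. Qed.

Lemma sphere_weightSS n (t : R) : (2 <= n)%N -> -1 < t < 1 ->
  sphere_weight n.+2 t = (1 - t ^+ 2) * sphere_weight n t.
Proof.
case: n => [|[|n]] // _ /onem_sqr_gt0 t0; rewrite /sphere_weight/= !(exprS (Num.sqrt _)).
have : 0 < Num.sqrt (1 - t ^+ 2) by rewrite sqrtr_gt0.
move: (sqr_sqrtr (ltW t0)); move: (Num.sqrt _) => r <- r0.
by field; rewrite gt_eqF.
Qed.

Lemma continuous_onem_sqr : continuous (fun t : R => 1 - t ^+ 2).
Proof. by move=> t; apply: cvgB; [exact: cvg_cst|exact: exprn_continuous]. Qed.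

Lemma continuous_sqrt_onem_sqr n :
  continuous (fun t : R => Num.sqrt (1 - t ^+ 2) ^+ n).
Proof.
move=> t; apply: (@continuous_comp _ _ _ (fun t : R => Num.sqrt (1 - t ^+ 2)) (fun x : R => x ^+ n)); last exact: exprn_continuous.
apply: (@continuous_comp _ _ _ (fun t : R => 1 - t ^+ 2) Num.sqrt); last exact: sqrt_continuous.
exact: continuous_onem_sqr.
Qed.

Lemma continuous_sphere_weight n (t : R) : -1 < t < 1 ->
  {for t, continuous (sphere_weight n)}.
Proof.
move=> /onem_sqr_gt0 t0; apply: cvgM; first exact: continuous_sqrt_onem_sqr.
by apply: cvgV; [rewrite gt_eqF|exact: continuous_onem_sqr].
Qed.

Lemma continuous_weight_horner n p (t : R) : -1 < t < 1 ->
  {for t, continuous (fun t => sphere_weight n t * p.[t])}.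
Proof.
by move=> t1; apply: cvgM; [exact: continuous_sphere_weight|exact: continuous_horner].
Qed.

Lemma measurable_weight_horner n p :
  measurable_fun Ioo (fun t => sphere_weight n t * p.[t]).
Proof.
apply: open_continuous_measurable_fun => // t.
by rewrite inE/= in_itv/=; exact: continuous_weight_horner.
Qed.

Lemma horner_bounded p : exists2 C : R, 0 <= C &
  forall t, -1 <= t <= 1 -> `|p.[t]| <= C.
Proof.
have m11 : -1 <= 1 :> R by lra.
have [|c _ cmax] := @EVT_max R (fun t => `|p.[t]|) (-1) 1 m11.
  apply: continuous_subspaceT => t; apply: cvg_norm; exact: continuous_horner.
by exists `|p.[c]| => // t t1; apply: cmax; rewrite in_itv.
Qed.

Lemma integral_sphere_weight2 :
  (\int[mu]_(t in Ioo) (sphere_weight 2 t)%:E)%E = (pi : R)%:E.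
Proof.
rewrite -[RHS]add0e -(integral0 mu Ioo).
rewrite (_ : pi = pi / 2 - - (pi / 2)); last by field.
apply: (@integral_N11 _ _ (fun=> 0) asin).
- by move=> t t1; rewrite ltW// sphere_weight_gt0.
- by [].
- exact: continuous_sphere_weight.
- by move=> *; exact: cvg_cst.
- move=> t t1; apply: (is_derive_eq (is_derive1_asin t1)).
  have t0 := onem_sqr_gt0 t1.
  rewrite subr0 /sphere_weight expr1 -[X in _ / X]sqr_sqrtr ?ltW//.
  by field; rewrite gt_eqF// sqrtr_gt0.
- exact: cvg_asinN1.
- exact: cvg_asin1.
Qed.

(** The arcsine density n = 2 dominates all others, so its finite mass and the boundedness of
    polynomials on [-1, 1] settle integrability in every dimension. *)
Lemma sphere_weight_le n (t : R) : (2 <= n)%N -> -1 < t < 1 ->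
  sphere_weight n t <= sphere_weight 2 t.
Proof.
case: n => [|[|n]] // _ t1; have t0 := onem_sqr_gt0 t1.
apply: ler_wpM2r; first by rewrite invr_ge0 ltW.
rewrite /= expr1 (exprS (Num.sqrt _)) -[leRHS]mulr1.
apply: ler_wpM2l; first exact: sqrtr_ge0.
rewrite exprn_ile1 ?sqrtr_ge0//.
by rewrite -[leRHS](@sqrtr1 R) ler_wsqrtr// lerBlDr lerDl sqr_ge0.
Qed.

Lemma integrable_weight_horner n p : (2 <= n)%N ->
  mu.-integrable Ioo (EFin \o (fun t => sphere_weight n t * p.[t])).
Proof.
move=> n2; have [C C0 pC] := horner_bounded p.
apply: (@le_integrable _ _ R mu Ioo _ _ (EFin \o (fun t : R => sphere_weight 2 t * C))) => //.
- by apply/measurable_EFinP; exact: measurable_weight_horner.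
- move=> t; rewrite /= in_itv/= => t1; rewrite lee_fin.
  have := sphere_weight_le n2 t1; have := sphere_weight_gt0 n t1.
  have := sphere_weight_gt0 2 t1.
  move: (sphere_weight n t) (sphere_weight 2 t) => a b b0 a0 ab.
  rewrite !normrM ler_pM//; first by rewrite !gtr0_norm.
  by rewrite [leRHS]ger0_norm// pC//; case/andP: t1 => *; rewrite !ltW.
- have mf : measurable_fun Ioo (fun t => sphere_weight 2 t * C).
    rewrite (_ : (fun t => _) = fun t => sphere_weight 2 t * C%:P.[t]).
      exact: measurable_weight_horner.
    by apply/funext => t; rewrite hornerC.
  apply/integrableP; split; first exact/measurable_EFinP.
  rewrite (_ : integral _ _ _ = (pi * C)%:E) ?ltry// EFinM -integral_sphere_weight2.
  rewrite -ge0_integralZr//=.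
  + apply: eq_integral => t; rewrite inE/= in_itv/= => t1.
    have := sphere_weight_gt0 2 t1; move: (sphere_weight 2 t) => a a0.
    by rewrite ger0_norm// mulr_ge0// ltW.
  + apply/measurable_EFinP; rewrite (_ : sphere_weight 2 = fun t => sphere_weight 2 t * (1 : {poly R}).[t]).
      exact: measurable_weight_horner.
    by apply/funext => t; rewrite hornerC mulr1.
  + by move=> t; rewrite in_itv/= => t1; rewrite lee_fin ltW// sphere_weight_gt0.
Qed.

(** The open interval avoids the endpoints, where [sphere_weight] divides by 0; [RintegralE_open]
    links it to the closed one. *)
Definition sphere_int n p : R :=
  \int[mu]_(t in Ioo) (sphere_weight n t * p.[t]).

Lemma sphere_intP n a p q : (2 <= n)%N ->
  sphere_int n (a *: p + q) = a * sphere_int n p + sphere_int n q.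
Proof.
move=> n2; rewrite /sphere_int.
have E t : sphere_weight n t * (a *: p + q).[t] =
    sphere_weight n t * (a *: p).[t] + sphere_weight n t * q.[t].
  by rewrite hornerD mulrDr.
under eq_Rintegral do rewrite E.
rewrite RintegralD//; [|exact: integrable_weight_horner..].
under [X in X + _]eq_Rintegral do rewrite hornerZ mulrCA.
by rewrite RintegralZl//; exact: integrable_weight_horner.
Qed.

Lemma RintegralE_open (f g : R -> R) : measurable_fun Ioo g ->
  (forall t : R, -1 < t < 1 -> f t = g t) ->
  \int[mu]_(t in `[-1, 1]) f t = \int[mu]_(t in Ioo) g t.
Proof.
move=> mg fg; have mf : measurable_fun Ioo f.
  apply: eq_measurable_fun mg => t; rewrite inE/= in_itv/= => t1.
  by rewrite fg.
rewrite /Rintegral integral_itv_bndoo; last exact/measurable_EFinP.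
by congr fine; apply: eq_integral => t; rewrite inE/= in_itv/= => /fg ->.
Qed.

Lemma mu_intE n p : (2 <= n)%N ->
  mu_int n p = gegenbauer_const R n * sphere_int n p.
Proof.
move=> n2; rewrite /mu_int /sphere_int -RintegralZl//; last first.
  exact: integrable_weight_horner.
apply: RintegralE_open.
  by apply: measurable_funM => //; exact: measurable_weight_horner.
by move=> t t1; rewrite sphere_weightE// mulrA.
Qed.

Lemma jacobi_intE n (a b : bool) p : (2 <= n)%N ->
  jacobi_int (a%:R + (n%:R - 3) / 2) (b%:R + (n%:R - 3) / 2) p =
  sphere_int n ((1 - 'X) ^+ a * (1 + 'X) ^+ b * p).
Proof.
move=> n2; apply: RintegralE_open; first exact: measurable_weight_horner.
move=> t t1; rewrite -sphere_weightE// !hornerE.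
have [t0 t2] : 0 < 1 - t /\ 0 < 1 + t by case/andP: t1 => *; split; lra.
rewrite (_ : 1 - t ^+ 2 = (1 - t) * (1 + t)); last by ring.
rewrite powRM ?ltW// !powRD ?(gt_eqF t0) ?(gt_eqF t2) ?implybT//.
rewrite !powR_mulrn ?ltW//=; ring.
Qed.

Lemma mem_rootsR p (t : R) : p != 0 -> (t \in rootsR p) = root p t.
Proof. by move=> p0; rewrite -(roots_on_rootsR p0) in_itv. Qed.

(** A zero integral would make p vanish almost everywhere on ]-1, 1[, which would then be covered by
    a null set and the finitely many roots of p. *)
Lemma sphere_int_gt0 n p : (2 <= n)%N -> p != 0 ->
  (forall t, -1 <= t <= 1 -> 0 <= p.[t]) -> 0 < sphere_int n p.
Proof.
move=> n2 p0 pge0.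
have Ioo_ge0 t : Ioo t -> 0 <= sphere_weight n t * p.[t].
  rewrite /= in_itv/= => t1; rewrite mulr_ge0 ?(ltW (sphere_weight_gt0 _ _))//.
  by apply: pge0; case/andP: t1 => *; rewrite !ltW.
have ip := integrable_weight_horner p n2.
rewrite lt_neqAle eq_sym Rintegral_ge0// andbT; apply/eqP => J0.
have mf := measurable_weight_horner n p.
have int0 : (\int[mu]_(t in Ioo) `|(EFin \o (fun t : R => (sphere_weight n t * p.[t])%R)) t|)%E = 0%E.
  rewrite [RHS](_ : _ = (sphere_int n p)%:E); last by rewrite J0.
  rewrite /sphere_int /Rintegral fineK.
    apply: eq_integral => t; rewrite inE => t1 /=.
    by rewrite ger0_norm// Ioo_ge0.
  exact: integrable_fin_num.
have [N [mN N0 sN]] : ae_eq mu Ioo (EFin \o (fun t => sphere_weight n t * p.[t])) (cst 0%E).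
  by apply/ae_eq_integral_abs => //; exact/measurable_EFinP.
have IN : Ioo `<=` N `|` [set` rootsR p].
  move=> t tI; have [tN|tN] := pselect (N t); first by left.
  right => /=; apply: contrapT => pt; apply: tN; apply: sN.
  move=> /(_ tI) /= [] /eqP; rewrite mulf_eq0 gt_eqF/=; last first.
    by apply: sphere_weight_gt0; move: tI; rewrite /= in_itv.
  by move=> pt0; apply: pt; rewrite mem_rootsR.
have : (mu Ioo <= mu N + mu [set` rootsR p])%E.
  have cR : measurable [set` rootsR p] by apply: countable_measurable => //; exact/finite_set_countable/finite_seq.
  rewrite (le_trans _ (measureU2 _ _ _))// le_measure// inE//.
  exact: measurableU.
rewrite [X in (X + _)%E]N0 (@countable_lebesgue_measure0 _ [set` rootsR p]); last first.
  exact/finite_set_countable/finite_seq.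
rewrite adde0 leNgt => /negP; apply.
rewrite [X in (_ < X)%E]lebesgue_measure_itv/= lte_fin ifT; last by lra.
by rewrite lte_fin opprK addr_gt0.
Qed.

(** Integration by parts: with r = sqrt(1 - t^2), the derivative of r^(n-1) p is the weight times (1
    - t^2) p' - (n - 1) t p, and the boundary values vanish because n - 1 >= 1. *)
Lemma sphere_int_deriv n p : (2 <= n)%N ->
  sphere_int n ((1 - 'X ^+ 2) * p^`()) = (n%:R - 1) * sphere_int n ('X * p).
Proof.
move=> n2.
pose q := (1 - 'X ^+ 2) * p^`() + (1 - n%:R) *: ('X * p).
suff q0 : sphere_int n q = 0.
  move: q0; rewrite /q addrC sphere_intP// => /eqP.
  rewrite addrC addr_eq0 => /eqP ->; ring.
(* Adding a bound of |q| makes both integrands nonnegative, as [integral_N11] requires; it cancels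
   at the end. *)
have [C C0 qC] := horner_bounded q.
have intE : (\int[mu]_(t in Ioo) (sphere_weight n t * (q + C%:P).[t])%:E =
   \int[mu]_(t in Ioo) (sphere_weight n t * C%:P.[t])%:E + (0 - 0)%:E)%E.
  apply: (@integral_N11 _ _ _ (fun t => Num.sqrt (1 - t ^+ 2) ^+ n.-1 * p.[t])).
  - move=> t t1; rewrite mulr_ge0 ?(ltW (sphere_weight_gt0 _ _))// hornerD hornerC.
    have /qC : -1 <= t <= 1 by case/andP: t1 => *; rewrite !ltW.
    by rewrite ler_norml => /andP[]; lra.
  - by move=> t t1; rewrite mulr_ge0 ?(ltW (sphere_weight_gt0 _ _))// hornerC.
  - by move=> *; exact: continuous_weight_horner.
  - by move=> *; exact: continuous_weight_horner.
  - move=> t t1; have t0 := onem_sqr_gt0 t1.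
    have d1 : is_derive t 1 (fun t : R => 1 - t ^+ 2) (- (2 * t)).
      have -> : (fun t : R => 1 - t ^+ 2) = horner (1 - 'X ^+ 2).
        by apply/funext => u; rewrite !hornerE.
      by apply: (is_derive_eq (is_derive_poly _ _)); rewrite !poly.derivE !hornerE/=; ring.
    have d2 := is_deriveX n.-1 (@is_derive1_comp R Num.sqrt (fun t : R => 1 - t ^+ 2) t _ _ (is_derive1_sqrt t0) d1).
    have -> : (fun t : R => Num.sqrt (1 - t ^+ 2) ^+ n.-1 * p.[t]) =
        (Num.sqrt \o (fun t : R => 1 - t ^+ 2)) ^+ n.-1 * horner p.
      by apply/funext => u; rewrite !fctE.
    apply: (is_derive_eq (is_deriveM d2 (is_derive_poly p t))).
    rewrite hornerD mulrDr addrK /q !hornerE /GRing.scale/= /sphere_weight.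
    clear -n2 t0; case: n n2 => [|[|n]] // _.
    have : 0 < Num.sqrt (1 - t ^+ 2) by rewrite sqrtr_gt0.
    rewrite !fctE/= (exprS (Num.sqrt _)) -(natr1 n.+1).
    move: (sqr_sqrtr (ltW t0)); move: (Num.sqrt _) => r rE r0.
    by rewrite -rE; field; rewrite gt_eqF.
  - rewrite -[X in _ --> X](mul0r p.[-1]).
    apply: cvgM; last by apply: cvg_at_right_filter; exact: continuous_horner.
    apply: cvg_at_right_filter; have := @continuous_sqrt_onem_sqr n.-1 (-1).
    rewrite /continuous_at sqrrN expr1n subrr sqrtr0 expr0n.
    by case: n n2 {q C C0 qC} => [|[|n]].
  - rewrite -[X in _ --> X](mul0r p.[1]).
    apply: cvgM; last by apply: cvg_at_left_filter; exact: continuous_horner.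
    apply: cvg_at_left_filter; have := @continuous_sqrt_onem_sqr n.-1 1.
    rewrite /continuous_at expr1n subrr sqrtr0 expr0n.
    by case: n n2 {q C C0 qC} => [|[|n]].
have : sphere_int n (q + C%:P) = sphere_int n C%:P.
  by rewrite /sphere_int /Rintegral intE subrr adde0.
by rewrite -[q]scale1r sphere_intP// mul1r scale1r => /eqP; rewrite -subr_eq0 addrK => /eqP.
Qed.

Lemma sphere_intSS n : (2 <= n)%N ->
  sphere_int n.+2 1 = (n%:R - 1) / n%:R * sphere_int n 1.
Proof.
move=> n2; have E : sphere_int n.+2 1 = sphere_int n (1 - 'X ^+ 2).
  apply: eq_Rintegral => t; rewrite inE/= in_itv/= => t1.
  by rewrite sphere_weightSS// hornerC mulr1 mulrC; congr (_ * _); rewrite !hornerE.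
have := sphere_int_deriv 'X n2; rewrite derivX mulr1 -expr2 -E => E2.
have : sphere_int n 1 = sphere_int n.+2 1 + sphere_int n ('X ^+ 2).
  have := sphere_intP 1 (1 - 'X ^+ 2) ('X ^+ 2) n2.
  by rewrite E mul1r scale1r subrK.
move: E2; have : n%:R != 0 :> R by rewrite pnatr_eq0; case: n n2 E.
move: (sphere_int n.+2 1) (sphere_int n 1) (sphere_int n ('X ^+ 2)) => x y z n0 E2 E3.
by rewrite E3 E2; field.
Qed.

Lemma mu_int1 n : (2 <= n)%N -> mu_int n (1 : {poly R}) = 1.
Proof.
move=> n2; rewrite mu_intE//.
have [m] := ubnP n; elim: m n n2 => // m IH [|[|[|[|n]]]] // _ nm.
- rewrite gegenbauer_const2 /sphere_int /Rintegral.
  under eq_integral do rewrite hornerC mulr1.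
  by rewrite integral_sphere_weight2/= mulVf// gt_eqF// pi_gt0.
- rewrite gegenbauer_const3 /sphere_int.
  rewrite (_ : \int[mu]_(t in Ioo) _ = \int[mu]_(t in Ioo) 1).
    rewrite Rintegral_cst// mul1r [X in fine X]lebesgue_measure_itv/= lte_fin ifT; last by lra.
    by rewrite /= opprK; field.
  apply: eq_Rintegral => t; rewrite inE/= in_itv/= => /onem_sqr_gt0 t0.
  by rewrite hornerC mulr1 /sphere_weight sqr_sqrtr ?ltW// divff// gt_eqF.
- rewrite gegenbauer_constSS// sphere_intSS// mulrACA.
  rewrite IH// ?mulr1; last by move: nm; rewrite !ltnS => /ltnW.
  have := ler0n R n; move: (n%:R) => x x0.
  by field; apply/andP; split; rewrite gt_eqF//; lra.
Qed.

End GegenbauerFunctional.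

(** * Positive functionals on polynomials *)

Section PositiveFunctional.
Variable R : realType.
Implicit Types (p q f F v rho : {poly R}) (J : {scalar {poly R}}) (Z : seq R).

Definition nonneg_poly p : Prop := forall t, -1 <= t <= 1 -> 0 <= p.[t].

(** Asked of all polynomials nonnegative on [-1, 1], not only of squares, so that the property
    survives multiplication by weights such as (1 - t)(1 + t)^e. *)
Definition pos_functional (J : {poly R} -> R) : Prop :=
  forall p, p != 0 -> nonneg_poly p -> 0 < J p.

Definition weighted (J : {poly R} -> R) rho p : R := J (rho * p).

Fact weighted_is_scalar J rho : scalar (weighted J rho).
Proof. by move=> a p q; rewrite /weighted mulrDr -scalerAr linearP. Qed.

HB.instance Definition _ J rho :=
  GRing.isLinear.Build R {poly R} R *%R (weighted J rho) (weighted_is_scalar J rho).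

Lemma pos_weighted J rho : pos_functional J -> rho != 0 -> nonneg_poly rho ->
  pos_functional (weighted J rho).
Proof.
move=> Jpos rho0 rhoge p p0 pge; apply: Jpos; first by rewrite mulf_neq0.
by move=> t t1; rewrite hornerM mulr_ge0 ?rhoge ?pge.
Qed.

Lemma nonneg_sqr v : nonneg_poly (v ^+ 2).
Proof. by move=> t _; rewrite horner_exp sqr_ge0. Qed.

Lemma pos_sqr (J : {poly R} -> R) v : pos_functional J -> v != 0 -> 0 < J (v ^+ 2).
Proof. by move=> Jpos v0; apply: Jpos; [rewrite expf_neq0|exact: nonneg_sqr]. Qed.

Lemma constant_sign F : (forall t, -1 < t < 1 -> ~~ root F t) ->
  nonneg_poly F \/ nonneg_poly (- F).
Proof.
move=> noroot; have [|/existsNP[t0 /not_implyP[t01 /negP]]] := pselect (nonneg_poly F).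
  by left.
rewrite -ltNge => Ft0; right => t1 t11; rewrite hornerN oppr_ge0 leNgt.
apply/negP => Ft1.
have Fmul : F.[t0] * F.[t1] <= 0 by rewrite nmulr_rle0// ltW.
have [x x01 rx] : exists2 x, Num.min t0 t1 <= x <= Num.max t0 t1 & root F x.
  have [t01'|/ltW t10] := leP t0 t1.
    by have [x xI rx] := polyrcf.poly_ivt t01' Fmul; exists x; rewrite in_itv in xI.
  rewrite mulrC in Fmul.
  by have [x xI rx] := polyrcf.poly_ivt t10 Fmul; exists x; rewrite in_itv in xI.
have xt0 : x != t0 by apply: contraTneq rx => ->; rewrite rootE lt_eqF.
have xt1 : x != t1 by apply: contraTneq rx => ->; rewrite rootE gt_eqF.
move: rx; apply/negP; apply: noroot.
have [m M] : -1 <= Num.min t0 t1 /\ Num.max t0 t1 <= 1.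
  move/andP: t01 => [? ?]; move/andP: t11 => [? ?].
  by split; rewrite (le_min, ge_max); apply/andP.
have mx : x != Num.min t0 t1 by rewrite /Num.min; case: ifP.
have Mx : x != Num.max t0 t1 by rewrite /Num.max; case: ifP.
move/andP: x01 => [l g]; apply/andP; split.
  by rewrite (le_lt_trans m)// lt_neqAle eq_sym mx.
by rewrite (lt_le_trans _ M)// lt_neqAle Mx.
Qed.

(* Splitting off a root z of F toggles the membership of z in Z. *)
Lemma sign_changes F : F != 0 -> exists Z,
  [/\ uniq Z, all (root F) Z, all (fun z => -1 < z < 1) Z &
   exists2 c : R, c != 0 & nonneg_poly (c *: (F * \prod_(z <- Z) ('X - z%:P)))].
Proof.
have [m] := ubnP (size F); elim: m F => // m IH F /ltnSE sF F0.
have [[z [z1 rz]]|noroot] := pselect (exists z, -1 < z < 1 /\ root F z); last first.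
  have [] := @constant_sign F.
  - by move=> t t1; apply/negP => rt; apply: noroot; exists t.
  - move=> Fge; exists [::]; split => //; exists 1; first exact: oner_neq0.
    by rewrite big_nil mulr1 scale1r.
  - move=> Fge; exists [::]; split => //; exists (-1); first by rewrite oppr_eq0 oner_eq0.
    by rewrite big_nil mulr1 scaleN1r.
have /factor_theorem[F1 FE] := rz.
have F10 : F1 != 0 by apply: contraNneq F0; rewrite FE => ->; rewrite mul0r.
have [|//|Z [uZ rZ iZ [c c0 cge]]] := IH F1.
  by move: sF; rewrite FE size_Mmonic ?monicXsubC// size_XsubC addn2.
have rF y : root F1 y -> root F y by rewrite FE rootM => ->.
have [zZ|zZ] := boolP (z \in Z).
  exists (rem z Z); split; first exact: rem_uniq.
  - by apply/allP => y /mem_rem yZ; apply: rF; exact: (allP rZ).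
  - by apply/allP => y /mem_rem yZ; exact: (allP iZ).
  - exists c => //; rewrite FE -mulrA.
    have <-// : \prod_(y <- Z) ('X - y%:P) =
        ('X - z%:P) * \prod_(y <- rem z Z) ('X - y%:P).
    by rewrite (perm_big _ (perm_to_rem zZ)) big_cons.
exists (z :: Z); split; rewrite /= ?zZ ?rz ?z1//.
- by apply/allP => y yZ; apply: rF; exact: (allP rZ).
- exists c => //; rewrite big_cons FE => t t1; have := cge t t1.
  rewrite !hornerZ !hornerM hornerXsubC => h.
  rewrite (_ : _ * _ = (t - z) ^+ 2 * (c * (F1.[t] * (\prod_(z <- Z) ('X - z%:P)).[t]))).
    by rewrite mulr_ge0// sqr_ge0.
  by ring.
Qed.

(** With fewer than k sign changes, F times the product over them would have a constant sign and
    hence a nonzero value under J, against orthogonality. *)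
Lemma orth_roots J F k : pos_functional J -> F != 0 ->
  (forall q, (size q <= k)%N -> J (F * q) = 0) ->
  exists Z, [/\ uniq Z, all (root F) Z, all (fun z => -1 < z < 1) Z & (k <= size Z)%N].
Proof.
move=> Jpos F0 Forth; have [Z [uZ rZ iZ [c c0 cge]]] := sign_changes F0.
exists Z; split => //; rewrite leqNgt; apply/negP => Zk.
have : 0 < J (c *: (F * \prod_(z <- Z) ('X - z%:P))).
  apply: Jpos => //; rewrite scale_poly_eq0 negb_or c0 mulf_neq0//.
  by rewrite monic_neq0// monic_prod_XsubC.
by rewrite linearZ/= Forth ?mulr0 ?ltxx// size_prod_XsubC.
Qed.

(** The Gram matrix of 1, ..., X^(k-1) is invertible since J is positive on squares; it projects X^k
    on lower degrees, and the residue is orthogonal to them. *)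
Lemma orth_poly_exists J k : pos_functional J -> exists p, is_orthogonal_poly J k p.
Proof.
move=> Jpos.
have rVE (u : 'rV[R]_k) : rVpoly u = \sum_(i < k) u 0 i *: 'X^i.
  by rewrite [LHS]poly_def; apply: eq_bigr => i _; rewrite valK.
pose G := \matrix_(i < k, j < k) J ('X^i * 'X^j).
have Gdot (u w : 'rV[R]_k) : (u *m G *m w^T) 0 0 = J (rVpoly u * rVpoly w).
  rewrite !rVE mulr_suml linear_sum !mxE.
  transitivity (\sum_(j < k) \sum_(i < k) u 0 i * G i j * w 0 j).
    by apply: eq_bigr => j _; rewrite !mxE mulr_suml; apply: eq_bigr => i _; rewrite !mxE.
  rewrite exchange_big/=; apply: eq_bigr => i _.
  rewrite mulr_sumr linear_sum; apply: eq_bigr => j _.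
  have -> : u 0 i *: 'X^i * (w 0 j *: 'X^j) = (u 0 i * w 0 j) *: ('X^i * 'X^j).
    by rewrite -scalerAl -scalerAr scalerA.
  by rewrite linearZ/= !mxE; ring.
have Gfree : row_free G.
  apply: inj_row_free => u uG; apply/eqP/contraT => u0.
  have : 0 < J (rVpoly u ^+ 2).
    apply: pos_sqr => //; apply: contraNneq u0 => ru.
    by rewrite -(rVpolyK u) ru linear0.
  by rewrite expr2 -Gdot uG mul0mx mxE ltxx.
pose b : 'rV[R]_k := \row_j J ('X^k * 'X^j).
pose r := rVpoly (b *m invmx G).
have sr : (size r <= k)%N by exact: size_poly.
exists ('X^k - r); split.
  by rewrite size_polyDl ?size_polyXn// size_polyN ltnS.
move=> q sq; have -> : q = rVpoly (poly_rV q : 'rV_k) by rewrite poly_rV_K.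
rewrite mulrBl linearB/= -Gdot mulmxKV -?row_free_unit//; apply/eqP; rewrite subr_eq0; apply/eqP.
rewrite rVE mulr_sumr linear_sum !mxE; apply: eq_bigr => j _.
by rewrite -scalerAr linearZ/= !mxE mulrC.
Qed.

(** Matching the coefficients of degree k leaves a difference of lower degree, which is orthogonal
    to itself. *)
Lemma orth_poly_unique J k p F : pos_functional J -> is_orthogonal_poly J k p ->
  (size F <= k.+1)%N -> (forall q, (size q <= k)%N -> J (F * q) = 0) ->
  exists c, F = c *: p.
Proof.
move=> Jpos [sp porth] sF Forth; exists (F`_k / p`_k).
have pk0 : p`_k != 0 by have := lead_coef_eq0 p; rewrite lead_coefE sp/= -size_poly_eq0 sp => ->.
set c := _ / _; have sD : (size (F - c *: p)%R <= k)%N.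
  apply/leq_sizeP => j; rewrite leq_eqVlt => /predU1P[<-|kj].
    by rewrite coefB coefZ /c divfK// subrr.
  by rewrite coefB coefZ !nth_default ?mulr0 ?subr0// ?sp// (leq_trans sF).
apply/eqP; rewrite -subr_eq0; apply: contraT => D0.
have := pos_sqr Jpos D0.
have -> : (F - c *: p) ^+ 2 = F * (F - c *: p) - c *: (p * (F - c *: p)).
  by rewrite expr2 {1}mulrBl -scalerAl.
move: (F - c *: p) sD => D sD.
by rewrite linearB linearZ/= Forth// porth// mulr0 subrr ltxx.
Qed.

(** If p = (X - 1) q, then J((1 - X) q^2) = - J(p q) = 0, against positivity. This is what permits
    normalization at 1. *)
Lemma orth_poly_at1 J k p : pos_functional J -> is_orthogonal_poly J k p -> p.[1] != 0.
Proof.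
move=> Jpos [sp porth]; apply/eqP => p1.
have /factor_theorem[q pE] : root p 1 by rewrite rootE p1.
have p0 : p != 0 by rewrite -size_poly_eq0 sp.
have q0 : q != 0 by apply: contraNneq p0; rewrite pE => ->; rewrite mul0r.
have sq : (size q <= k)%N.
  by move: sp; rewrite pE size_Mmonic ?monicXsubC// size_XsubC addn2/= => -[->].
have : 0 < J ((1 - 'X) * q ^+ 2).
  apply: Jpos; first by rewrite mulf_neq0 ?expf_neq0// -opprB oppr_eq0 -[1]/(1%:P) polyXsubC_eq0.
  by move=> t /andP[_ t1]; rewrite hornerM horner_exp mulr_ge0 ?sqr_ge0// !hornerE subr_ge0.
have -> : (1 - 'X) * q ^+ 2 = - (p * q) by rewrite pE; ring.
by rewrite linearN/= porth// oppr0 ltxx.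
Qed.

Lemma orth_poly_scale J k p c : c != 0 -> is_orthogonal_poly J k p ->
  is_orthogonal_poly J k (c *: p).
Proof.
move=> c0 [sp porth]; split; first by rewrite size_scale.
by move=> q sq; rewrite -scalerAl linearZ/= porth// mulr0.
Qed.

Lemma orth_poly_normalized J k y : pos_functional J -> y != 0 ->
  exists p, is_orthogonal_poly J k p /\ p.[1] = y.
Proof.
move=> Jpos y0; have [p porth] := orth_poly_exists k Jpos.
have p1 := orth_poly_at1 Jpos porth.
exists ((y / p.[1]) *: p); rewrite hornerZ divfK//; split=> //.
by apply: orth_poly_scale => //; rewrite mulf_neq0 ?invr_eq0.
Qed.

(** The Lagrange basis polynomial, left unnormalized like the l_i that define the weights rho_i. *)
Definition node_poly Z (z : R) : {poly R} := \prod_(y <- Z | y != z) ('X - y%:P).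

Lemma node_poly_eq0 Z y z : y \in Z -> y != z -> (node_poly Z z).[y] = 0.
Proof.
move=> yZ yz; apply/eqP; rewrite -rootE /node_poly -big_filter root_prod_XsubC.
by rewrite mem_filter yz.
Qed.

Lemma node_poly_neq0 Z z : (node_poly Z z).[z] != 0.
Proof.
by rewrite -rootE /node_poly -big_filter root_prod_XsubC mem_filter eqxx.
Qed.

Lemma size_node_poly Z z : z \in Z -> (size (node_poly Z z) <= size Z)%N.
Proof.
move=> zZ; rewrite /node_poly -big_filter size_prod_XsubC size_filter.
rewrite -(count_predC (fun y => y != z) Z) -[X in (X < _)%N]addn0 ltn_add2l.
by rewrite -has_count; apply/hasP; exists z => //=; rewrite negbK.
Qed.

Lemma interpolation_eq Z f (g : {poly R}) : uniq Z -> (size f <= size Z)%N ->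
  (size g <= size Z)%N -> (forall z, z \in Z -> f.[z] = g.[z]) -> f = g.
Proof.
move=> uZ sf sg fg; apply/eqP; rewrite -subr_eq0; apply/negPn/negP => fg0.
have : (size Z < size (f - g)%R)%N.
  apply: max_poly_roots => //; apply/allP => z zZ.
  by rewrite rootE hornerD hornerN fg// subrr.
rewrite ltnNge => /negP; apply.
by rewrite (leq_trans (size_polyD _ _))// size_polyN geq_max sf.
Qed.

Definition interpolant Z (u : R -> R) : {poly R} :=
  \sum_(z <- Z) (u z / (node_poly Z z).[z]) *: node_poly Z z.

Lemma size_interpolant Z u : (size (interpolant Z u) <= size Z)%N.
Proof.
rewrite /interpolant big_seq; elim/big_ind : _ => [|p q sp sq|z zZ].
- by rewrite size_poly0.
- by rewrite (leq_trans (size_polyD _ _))// geq_max sp.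
- by rewrite (leq_trans (size_scale_leq _ _))// size_node_poly.
Qed.

Lemma horner_interpolant Z u z : uniq Z -> z \in Z -> (interpolant Z u).[z] = u z.
Proof.
move=> uZ zZ; rewrite /interpolant horner_sum (bigD1_seq z)//= hornerZ divfK ?node_poly_neq0//.
rewrite big1_seq ?addr0// => y /andP[yz yZ].
have zy : z != y by rewrite eq_sym.
by rewrite hornerZ (node_poly_eq0 zZ zy) mulr0.
Qed.

Lemma interpolantK Z f : uniq Z -> (size f <= size Z)%N -> f = interpolant Z (horner f).
Proof.
move=> uZ sf; apply: (interpolation_eq uZ) => //; first exact: size_interpolant.
by move=> z zZ; rewrite horner_interpolant.
Qed.

Lemma quadrature J Z m f : uniq Z ->
  (forall q, (size q <= m)%N -> J (\prod_(z <- Z) ('X - z%:P) * q) = 0) ->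
  (size f <= size Z + m)%N ->
  J f = \sum_(z <- Z) f.[z] * (J (node_poly Z z) / (node_poly Z z).[z]).
Proof.
move=> uZ Jorth sf; set w := \prod_(z <- Z) ('X - z%:P) in Jorth.
have w0 : w != 0 by rewrite monic_neq0// monic_prod_XsubC.
have sw : size w = (size Z).+1 by rewrite size_prod_XsubC.
have sr : (size (f %% w)%R <= size Z)%N by rewrite -ltnS -sw ltn_modp.
have fE z : z \in Z -> (f %% w).[z] = f.[z].
  move=> zZ; rewrite [in RHS](divp_eq f w) hornerD hornerM.
  by rewrite (_ : w.[z] = 0) ?mulr0 ?add0r//; apply/eqP; rewrite -rootE root_prod_XsubC.
rewrite [in LHS](divp_eq f w) linearD/= mulrC Jorth ?add0r; last first.
  by rewrite size_divp// sw leq_subLR.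
rewrite [in LHS](interpolantK uZ sr) linear_sum; apply: eq_big_seq => z zZ.
by rewrite /= linearZ/= fE// mulrAC mulrA.
Qed.

(** The weight at z is positive by testing on the square of [node_poly Z z], of degree 2 k - 2. *)
Lemma gauss_quadrature J k p : pos_functional J -> is_orthogonal_poly J k p ->
  exists (Z : seq R) (a : R -> R),
  [/\ uniq Z, size Z = k, forall z, z \in Z -> root p z /\ 0 < a z &
   forall f, (size f <= k + k)%N -> J f = \sum_(z <- Z) f.[z] * a z].
Proof.
move=> Jpos [sp porth]; have p0 : p != 0 by rewrite -size_poly_eq0 sp.
have [Z [uZ rZ _ kZ]] := orth_roots Jpos p0 porth.
have sZ : size Z = k.
  by apply/eqP; rewrite eqn_leq kZ andbT -ltnS -sp max_poly_roots.
have pE : p = lead_coef p *: \prod_(z <- Z) ('X - z%:P).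
  by apply: all_roots_prod_XsubC; rewrite ?uniq_rootsE ?sZ.
have lp0 : lead_coef p != 0 by rewrite lead_coef_eq0.
have Jf f : (size f <= k + k)%N ->
    J f = \sum_(z <- Z) f.[z] * (J (node_poly Z z) / (node_poly Z z).[z]).
  move=> sf; apply: (quadrature (m := k)) => //; last by rewrite sZ.
  move=> q sq; have := porth q sq; rewrite pE -scalerAl linearZ/= => /eqP.
  by rewrite mulf_eq0 (negPf lp0) => /eqP.
exists Z, (fun z => J (node_poly Z z) / (node_poly Z z).[z]); split => // z zZ.
split; first exact: (allP rZ).
have n0 : node_poly Z z != 0.
  by apply: contraNneq (node_poly_neq0 Z z) => ->; rewrite horner0.
have := pos_sqr Jpos n0; rewrite Jf; last first.
  rewrite expr2 (leq_trans (size_polyMleq _ _))//.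
  rewrite -sZ (leq_trans (leq_pred _))// leq_add// size_node_poly//.
rewrite (bigD1_seq z)//= big1_seq ?addr0; last first.
  by move=> y /andP[yz yZ]; rewrite horner_exp (node_poly_eq0 yZ yz) expr0n mul0r.
by rewrite horner_exp pmulr_rgt0// exprn_even_gt0//= node_poly_neq0.
Qed.

(** The degree is at most 2 k - 1, so the value is a sum of terms (s - z) v(z)^2 >= 0 with positive
    weights. If it vanishes, v is zero at every node other than s; having degree below k, it cannot
    be zero at all k nodes, so s is one of them. *)
Lemma gauss_sign J k p s v : pos_functional J -> is_orthogonal_poly J k p ->
  (forall z, root p z -> z <= s) -> v != 0 -> (size v <= k)%N ->
  0 <= J ((s%:P - 'X) * v ^+ 2) /\ (J ((s%:P - 'X) * v ^+ 2) = 0 -> root p s).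
Proof.
move=> Jpos porth zs v0 sv.
have [Z [a [uZ sZ Zp ->]]] := gauss_quadrature Jpos porth; last first.
  rewrite -opprB mulNr size_polyN (leq_trans (size_polyMleq _ _))// size_XsubC/=.
  have sv2 := size_polyMleq v v; have v1 : (0 < size v)%N by rewrite size_poly_gt0.
  move: sv2 v1 sv; rewrite -expr2.
  by move: (size (v ^+ 2)%R) (size v) => x y; lia.
have vE z : ((s%:P - 'X) * v ^+ 2).[z] = (s - z) * v.[z] ^+ 2 by rewrite !hornerE.
have term_ge0 z : z \in Z -> 0 <= ((s%:P - 'X) * v ^+ 2).[z] * a z.
  move=> zZ; have [rz az] := Zp z zZ.
  by rewrite vE mulr_ge0 ?(ltW az)// mulr_ge0 ?sqr_ge0// subr_ge0 zs.
split; first by rewrite big_seq; apply: sumr_ge0.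
move=> /eqP; rewrite big_seq psumr_eq0// => /allP J0.
apply: contraT => ps.
suff : (size Z < size v)%N by rewrite sZ ltnNge sv.
apply: max_poly_roots => //; apply/allP => z zZ.
have [rz az] := Zp z zZ; have := J0 z zZ; rewrite zZ vE/=.
rewrite !mulf_eq0 (gt_eqF az) orbF subr_eq0 orbb => /orP[/eqP sz|].
  by rewrite sz rz in ps.
by rewrite rootE.
Qed.

End PositiveFunctional.

(** * Gegenbauer polynomials and their kernels *)

Section Ultraspherical.
Variables (R : realType) (n : nat) (I : {scalar {poly R}}) (P : nat -> {poly R}).
Hypothesis n2 : (2 <= n)%N.
Hypothesis Ipos : pos_functional I.
Hypothesis I1 : I 1 = 1.
Hypothesis Ider : forall p, I ((1 - 'X ^+ 2) * p^`()) = (n%:R - 1) * I ('X * p).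
Hypothesis Porth : forall k, is_orthogonal_poly I k (P k).
Hypothesis P1 : forall k, (P k).[1] = 1.
Implicit Types (p q f g : {poly R}) (k : nat).

Let N1_gt0 : 0 < n%:R - 1 :> R.
Proof. by rewrite subr_gt0 ltr1n. Qed.

Let N_ge2 : 2 <= n%:R :> R.
Proof. by rewrite ler_nat. Qed.

Let sizeP k : size (P k) = k.+1.
Proof. by have [] := Porth k. Qed.

Let P_neq0 k : P k != 0.
Proof. by rewrite -size_poly_eq0 sizeP. Qed.

Let IZ a p : I (a *: p) = a * I p.
Proof. by rewrite linearZ. Qed.

Let ID p q : I (p + q) = I p + I q.
Proof. by rewrite linearD. Qed.

Let leadP k : (P k)`_k != 0.
Proof. by have := lead_coef_eq0 (P k); rewrite lead_coefE sizeP /= => ->. Qed.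

(** Symmetry follows from [Ider]: at p = 1 it kills the first moment, and at X^(k+1) it ties the
    moment of order k + 2 to that of order k. *)
Lemma odd_moment_eq0 j : I 'X^(j.*2.+1) = 0.
Proof.
elim: j => [|j IH].
  have := Ider 1; rewrite derivC mulr0 linear0 mulr1 => /esym/eqP.
  by rewrite mulf_eq0 (gt_eqF N1_gt0) => /eqP; rewrite expr1.
rewrite doubleS; set k := j.*2.+1 in IH *.
have := Ider 'X^(k.+1); rewrite derivXn /= -exprS mulrnAr linearMn/= mulrBl mul1r.
rewrite -exprD linearB/= IH add0r (_ : 2 + k = k.+2)%N// mulNrn => h.
have /eqP : (k.+1%:R + (n%:R - 1)) * I 'X^(k.+2) = 0 by rewrite mulrDl -h mulr_natl subrr.
have k0 : 0 < k.+1%:R + (n%:R - 1) :> R by rewrite addr_gt0 ?ltr0n.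
by rewrite mulf_eq0 (gt_eqF k0) => /eqP.
Qed.

Lemma comp_polyNXE p : p \Po (- 'X) = \poly_(i < size p) ((-1) ^+ i * p`_i).
Proof.
rewrite comp_polyE poly_def; apply: eq_bigr => i _.
by rewrite -scaleN1r exprZn scalerA mulrC.
Qed.

Lemma reflection_invariant p : I (p \Po (- 'X)) = I p.
Proof.
rewrite comp_polyNXE poly_def -[in RHS](coefK p) poly_def !linear_sum.
apply: eq_bigr => i _; rewrite !linearZ/=.
have [oi|ei] := boolP (odd i).
  by rewrite -(odd_double_half i) oi add1n odd_moment_eq0 !mulr0.
by rewrite -signr_odd (negPf ei) mul1r.
Qed.

Lemma gegenbauer_reflection k : P k \Po (- 'X) = (-1) ^+ k *: P k.
Proof.
have [|q sq|c cE] := @orth_poly_unique _ I k (P k) (P k \Po (- 'X)) Ipos (Porth k).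
- by rewrite comp_polyNXE -[X in (_ <= X)%N](sizeP k) size_poly.
- have -> : (P k \Po (- 'X)) * q = (P k * (q \Po (- 'X))) \Po (- 'X).
    rewrite comp_polyM; congr (_ * _); rewrite -comp_polyA.
    by rewrite (_ : - 'X \Po - 'X = 'X) ?comp_polyXr// raddfN/= comp_polyX opprK.
  rewrite reflection_invariant; apply: (Porth k).2.
  by rewrite comp_polyNXE (leq_trans (size_poly _ _)).
rewrite cE; congr (_ *: _); have := congr1 (fun p => p`_k) cE.
by rewrite comp_polyNXE coef_poly sizeP ltnSn coefZ => /(mulIf (leadP k)).
Qed.

Lemma gegenbauer_atN1 k : (P k).[-1] = (-1) ^+ k.
Proof.
have := congr1 (horner^~ 1) (gegenbauer_reflection k).
by rewrite horner_comp !hornerE P1 mulr1.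
Qed.

Lemma gegenbauer_X_sqr k : I ('X * P k * P k) = 0.
Proof.
have := reflection_invariant ('X * P k * P k).
rewrite !comp_polyM comp_polyX gegenbauer_reflection.
rewrite (_ : _ * _ = - ('X * P k * P k)); last first.
  rewrite -!mul_polyC polyC_exp polyCN; set s := (- 1%:P) ^+ k.
  have s2 : s * s = 1 by rewrite /s -exprMn mulrNN mulr1 expr1n.
  by rewrite -[RHS]mulr1 -s2; ring.
by rewrite linearN /=; lra.
Qed.

(** The Laplacian of the sphere acting on functions of one inner product. *)
Definition gegenbauer_ode p : {poly R} :=
  (1 - 'X ^+ 2) * p^`()^`() - (n%:R - 1) *: ('X * p^`()).

Lemma gegenbauer_ode_sym f g : I (f * gegenbauer_ode g) = I (g * gegenbauer_ode f).
Proof.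
suff E f' g' : I (f' * gegenbauer_ode g') = - I ((1 - 'X ^+ 2) * (f'^`() * g'^`())).
  by rewrite !E [f^`() * _]mulrC.
have := Ider (f' * g'^`()); rewrite derivM mulrDr linearD/= => h.
rewrite /gegenbauer_ode mulrBr linearB/= -scalerAr linearZ/=.
rewrite (_ : f' * ('X * _) = 'X * (f' * g'^`())); last by ring.
rewrite -h opprD addrCA (_ : f' * _ = (1 - 'X ^+ 2) * (f' * g'^`()^`())); last by ring.
by rewrite subrr addr0.
Qed.

Lemma coef_gegenbauer_ode p j : (gegenbauer_ode p)`_j =
  (j.+2 * j.+1)%:R * p`_j.+2 - j%:R * (j%:R + n%:R - 2) * p`_j.
Proof.
have c1 i : p^`()`_i = i.+1%:R * p`_i.+1 by rewrite coef_deriv mulr_natl.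
have c2 i : p^`()^`()`_i = (i.+2 * i.+1)%:R * p`_i.+2.
  by rewrite coef_deriv c1 -mulrnAl -mulrnA.
rewrite /gegenbauer_ode coefB mulrBl coefB mul1r coefZ coefXM.
rewrite -['X ^+ 2]/('X^2) coefXnM !c2 !c1.
case: j => [|[|j]] /=.
- by rewrite mulr0 !mul0r !subr0.
- by rewrite subr0 mul1r; ring.
- rewrite subn2/= !natrM -[j.+4]addn4 -[j.+3]addn3 -[j.+2]addn2 -[j.+1]addn1 !natrD.
  ring.
Qed.

(** The operator is self-adjoint for I and does not raise degrees, so the image of P k is again
    orthogonal to lower degrees; the eigenvalue is read off the top coefficient. *)
Lemma gegenbauer_ode_eigen k :
  gegenbauer_ode (P k) = - (k%:R * (k%:R + n%:R - 2)) *: P k.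
Proof.
have sD p m : (size p <= m)%N -> (size (gegenbauer_ode p) <= m)%N.
  move=> sp; apply/leq_sizeP => j mj; rewrite coef_gegenbauer_ode.
  by rewrite !nth_default ?mulr0 ?subrr// (leq_trans sp)// (leq_trans mj)// leqW.
have [|q sq|c cE] := @orth_poly_unique _ I k (P k) (gegenbauer_ode (P k)) Ipos (Porth k).
- by apply: sD; rewrite sizeP.
- by rewrite mulrC gegenbauer_ode_sym (Porth k).2// sD.
rewrite cE; congr (_ *: _); have := congr1 (fun p => p`_k) cE.
rewrite coefZ coef_gegenbauer_ode nth_default ?sizeP ?leqnSn// mulr0 sub0r -mulNr.
by move=> /(mulIf (leadP k)).
Qed.

(** At 1 the second-order term of the differential equation drops out. *)
Lemma deriv_gegenbauer_at1 k :
  (P k)^`().[1] = k%:R * (k%:R + n%:R - 2) / (n%:R - 1).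
Proof.
have := congr1 (horner^~ 1) (gegenbauer_ode_eigen k).
rewrite /gegenbauer_ode !hornerE P1 => h; apply: (mulfI (lt0r_neq0 N1_gt0)).
rewrite [RHS]mulrC divfK ?lt0r_neq0//.
by move: h; rewrite expr1n /=; move: (P k)^`().[1] => u; lra.
Qed.

(* The coefficient b of P (k + 1) vanishes by parity; the other two are read off
   the values and the derivatives at 1. *)
Lemma three_term k : (2 * k.+1%:R + n%:R - 2) *: ('X * P k.+1) =
  (k.+1%:R + n%:R - 2) *: P k.+2 + k.+1%:R *: P k.
Proof.
pose a := (P k.+1)`_k.+1 / (P k.+2)`_k.+2.
pose r0 := 'X * P k.+1 - a *: P k.+2.
pose b := r0`_k.+1 / (P k.+1)`_k.+1.
have [|q sq|c cE] := @orth_poly_unique _ I k (P k) (r0 - b *: P k.+1) Ipos (Porth k).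
- apply/leq_sizeP => j; rewrite leq_eqVlt => /predU1P[<-|].
    by rewrite coefB coefZ /b divfK ?subrr.
  rewrite leq_eqVlt => /predU1P[<-|kj].
    by rewrite /r0 !coefB !coefZ coefXM /= /a divfK// subrr nth_default ?mulr0 ?subrr// sizeP.
  rewrite /r0 !coefB !coefZ coefXM; case: j kj => //= j kj.
  by rewrite !nth_default ?mulr0 ?subrr// sizeP// ltnW.
- rewrite /r0 !mulrBl -!scalerAl !linearB !linearZ/=.
  rewrite [I (P k.+1 * q)](Porth k.+1).2; last by rewrite (leq_trans sq).
  rewrite (Porth k.+2).2; last by rewrite (leq_trans sq)// leqW.
  rewrite !(oppr0, scaler0, addr0) (_ : 'X * P k.+1 * q = P k.+1 * ('X * q)); last by ring.
  by rewrite (Porth k.+1).2// (leq_trans (size_polyMleq _ _))// size_polyX.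
have b0 : b = 0.
  have := congr1 (fun p => I (p * P k.+1)) cE.
  have o1 : I (P k.+2 * P k.+1) = 0 by apply: (Porth k.+2).2; rewrite sizeP.
  have o2 : I (P k * P k.+1) = 0 by rewrite mulrC; apply: (Porth k.+1).2; rewrite sizeP.
  rewrite /r0 !mulrBl -!scalerAl !linearB !linearZ/= gegenbauer_X_sqr o1 o2.
  rewrite mulr0 oppr0 scaler0 !add0r scalerN => /eqP.
  rewrite oppr_eq0 scaler_eq0 -expr2 (gt_eqF (pos_sqr Ipos (P_neq0 k.+1))) orbF.
  by move/eqP.
have E : 'X * P k.+1 = a *: P k.+2 + c *: P k.
  by rewrite -cE b0 scale0r subr0 /r0 subrKC.
have ac : a + c = 1.
  by have := congr1 (horner^~ 1) E; rewrite !hornerE !P1 !mulr1 => <-.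
have aE : (2 * k.+1%:R + n%:R - 2) * a = k.+1%:R + n%:R - 2.
  have h := congr1 (fun p => p^`().[1]) E.
  rewrite !poly.derivE !hornerE P1 in h.
  have d j : (P j)^`().[1] * (n%:R - 1) = j%:R * (j%:R + n%:R - 2).
    by rewrite deriv_gegenbauer_at1 divfK// lt0r_neq0.
  move: (d k) (d k.+1) (d k.+2) h; rewrite -(natr1 k.+1) -(natr1 k).
  move: ((P k)^`().[1]) ((P k.+1)^`().[1]) ((P k.+2)^`().[1]) => d0 d1 d2 e0 e1 e2 h.
  have c1 : c = 1 - a by lra.
  have h' : (1 + d1) * (n%:R - 1) = (a * d2 + (1 - a) * d0) * (n%:R - 1) by rewrite h c1.
  have h2 : n%:R - 1 + d1 * (n%:R - 1) =
      a * (d2 * (n%:R - 1)) + (1 - a) * (d0 * (n%:R - 1)) by move: h'; lra.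
  by move: h2; rewrite e0 e1 e2; lra.
rewrite E scalerDr !scalerA aE (_ : _ * c = k.+1%:R)//.
have -> : c = 1 - a by lra.
by rewrite mulrBr aE; ring.
Qed.

Definition gegenbauer_kernel k : {poly R} := (P k.+1 - P k) %/ ('X - 1%:P).

Lemma gegenbauer_kernelE k : (1 - 'X) * gegenbauer_kernel k = P k - P k.+1.
Proof.
rewrite (_ : 1 - 'X = - ('X - 1%:P)); last by rewrite opprB.
rewrite mulNr mulrC divpK ?opprB//.
by rewrite dvdp_XsubCl rootE !hornerE !P1 subrr.
Qed.

Lemma onemX_neq0 : 1 - 'X != 0 :> {poly R}.
Proof. by rewrite -opprB oppr_eq0 -[1]/(1%:P) polyXsubC_eq0. Qed.

Lemma size_gegenbauer_kernel k : size (gegenbauer_kernel k) = k.+1.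
Proof.
rewrite size_divp ?polyXsubC_eq0// size_XsubC subn1/= size_polyDl ?sizeP//.
by rewrite size_polyN sizeP.
Qed.

(** Write p = p(1) + (X - 1) q with deg q < k: the second part contributes nothing because (1 - X)
    U_k = P_k - P_(k+1). *)
Lemma gegenbauer_kernel_repr k p : (size p <= k.+1)%N ->
  I (gegenbauer_kernel k * p) = I (gegenbauer_kernel k) * p.[1].
Proof.
move=> sp; have /factor_theorem[q qE] : root (p - p.[1]%:P) 1.
  by rewrite rootE !hornerE subrr.
have sq : (size q <= k)%N.
  have [->|q0] := eqVneq q 0; first by rewrite size_poly0.
  have : (size (p - p.[1]%:P)%R <= k.+1)%N.
    rewrite (leq_trans (size_polyD _ _))// geq_max sp size_polyN.
    by rewrite (leq_trans (size_polyC_leq1 _)).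
  by rewrite qE size_Mmonic ?monicXsubC// size_XsubC addn2.
have -> : gegenbauer_kernel k * p =
    p.[1] *: gegenbauer_kernel k - (1 - 'X) * gegenbauer_kernel k * q.
  rewrite -{1}[p](subrK p.[1]%:P) qE -mul_polyC polyC1; ring.
rewrite linearB linearZ/= gegenbauer_kernelE mulrBl linearB/=.
by rewrite (Porth k).2// (Porth k.+1).2 ?leqW// subrr subr0 mulrC.
Qed.

(** So U_k is a Jacobi polynomial up to scale. For e = 1 it is proportional to the one whose largest
    zero is the left end of I_q. *)
Lemma gegenbauer_kernel_orth k :
  is_orthogonal_poly (weighted I (1 - 'X)) k (gegenbauer_kernel k).
Proof.
split; first exact: size_gegenbauer_kernel.
move=> q sq; rewrite /weighted mulrA gegenbauer_kernelE mulrBl linearB/=.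
by rewrite (Porth k).2// (Porth k.+1).2 ?leqW// subrr.
Qed.

Lemma gegenbauer_kernel_rec k :
  (k.+1%:R + n%:R - 2) *: gegenbauer_kernel k.+1 =
  (2 * k.+1%:R + n%:R - 2) *: P k.+1 + k.+1%:R *: gegenbauer_kernel k.
Proof.
apply: (mulfI onemX_neq0); rewrite mulrDr -!scalerAr !gegenbauer_kernelE mulrBl mul1r.
rewrite !scalerBr three_term.
rewrite -!mul_polyC !(rmorphD, rmorphB, rmorphM)/=; ring.
Qed.

Lemma gegenbauer_kernel_at1 k :
  (gegenbauer_kernel k).[1] = (2 * k%:R + n%:R - 1) / (n%:R - 1).
Proof.
have h := congr1 (fun p => p^`().[1]) (gegenbauer_kernelE k).
rewrite !poly.derivE !hornerE subrr mul0r addr0 in h.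
have -> : (gegenbauer_kernel k).[1] = (P k.+1)^`().[1] - (P k)^`().[1] by lra.
by rewrite !deriv_gegenbauer_at1 -natr1; field; rewrite lt0r_neq0.
Qed.

(** As P_(k+1) integrates to 0, [gegenbauer_kernel_rec] gives (k + n - 1) I(U_(k+1)) = (k + 1)
    I(U_k), the recursion of an inverse binomial. This is the origin of the binomial factor of
    L_q. *)
Lemma gegenbauer_kernel_int k :
  I (gegenbauer_kernel k) * 'C(n + k - 2, n - 2)%:R = 1.
Proof.
elim: k => [|k IH].
  rewrite addn0 binn mulr1.
  have P0 : P 0 = 1.
    have := P1 0; have /size_poly1P[c c0 ->] : size (P 0) == 1%N by rewrite sizeP.
    by rewrite hornerC => ->.
  have /size_poly1P[c c0 cE] : size (gegenbauer_kernel 0) == 1%N by rewrite size_gegenbauer_kernel.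
  have := congr1 I (gegenbauer_kernelE 0).
  rewrite P0 linearB /= -[P 1]mulr1 (Porth 1).2 ?size_poly1// subr0 I1 cE mulrC.
  rewrite mul_polyC linearZ linearB /= I1 -[X in I X]expr1 (odd_moment_eq0 0) subr0 mulr1.
  by rewrite -[c%:P]mulr1 mul_polyC linearZ/= I1 mulr1.
have := congr1 I (gegenbauer_kernel_rec k).
have o : I (P k.+1) = 0 by rewrite -[P _]mulr1; apply: (Porth k.+1).2; rewrite size_poly1.
rewrite ID !IZ o mulr0 add0r => h.
have kn0 : k.+1%:R != 0 :> R by rewrite pnatr_eq0.
apply: (mulfI kn0); rewrite mulr1 mulrCA -natrM.
have -> : (k.+1 * 'C(n + k.+1 - 2, n - 2) = (n + k.+1 - 2) * 'C(n + k - 2, n - 2))%N.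
  have := mul_bin_down (n + k.+1 - 2) (n - 2).
  by rewrite (_ : (n + k.+1 - 2).-1 = n + k - 2)%N 1?(_ : n + k.+1 - 2 - (n - 2) = k.+1)%N; lia.
rewrite natrM mulrA (_ : (n + k.+1 - 2)%:R = k.+1%:R + n%:R - 2); last first.
  by rewrite natrB ?natrD; [ring|lia].
by rewrite [I _ * _]mulrC h -mulrA IH mulr1.
Qed.

End Ultraspherical.

(** * The Levenshtein nodes and quadrature *)

Lemma uniq_mem_rem (T : eqType) (s : seq T) :
  (forall x, x \in s -> x \notin rem x s) -> uniq s.
Proof.
move=> h; apply: count_mem_uniq => x; have [xs|xs] := boolP (x \in s).
  have /permP/(_ (pred1 x)) -> := perm_to_rem xs.
  by rewrite /= eqxx (count_memPn (h x xs)).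
exact/count_memPn.
Qed.

Section NodeLocation.
(* J and J' stand for integration against (1 - t)(1 + t)^e dmu and
   (1 - t)(1 + t)^(1 - e) dmu. *)
Variables (R : realType) (J J' : {scalar {poly R}}) (l : nat) (e : bool) (s : R).
Hypothesis Jpos : pos_functional J.
Hypothesis J'pos : pos_functional J'.
Hypothesis J'E : forall v, J' ((1 + 'X) ^+ e * ((1 + 'X) ^+ e * v)) = J ((1 + 'X) * v).
Hypothesis l1 : (1 <= l)%N.
Hypothesis s1 : -1 <= s.
Implicit Types (p q v F : {poly R}).

Let JZ a p : J (a *: p) = a * J p. Proof. exact: linearZ. Qed.
Let JD p q : J (p + q) = J p + J q. Proof. exact: linearD. Qed.
Let JB p q : J (p - q) = J p - J q. Proof. exact: linearB. Qed.
Let JN p : J (- p) = - J p. Proof. exact: linearN. Qed.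

Lemma onepX_neq0 : 1 + 'X != 0 :> {poly R}.
Proof. by rewrite addrC -[1]/(1%:P) -[1%:P]opprK -polyCN polyXsubC_eq0. Qed.

(** The Jacobi polynomial behind t_(l-1+e)^(1,1-e), the left end of I_q. *)
Variable jac : {poly R}.
Hypothesis jac_orth : is_orthogonal_poly J' (l - 1 + e) jac.
Hypothesis jac_le : forall z, root jac z -> z <= s.

(** By [J'E] the value is J'((s - X) u^2) with u = (1 + X)^e v, of degree below l - 1 + e, so Gauss
    quadrature at the zeros of [jac] applies. *)
Lemma lower_form v : (size v <= l - 1)%N -> v != 0 ->
  0 <= J ((1 + 'X) * ((s%:P - 'X) * v ^+ 2)) /\
  (J ((1 + 'X) * ((s%:P - 'X) * v ^+ 2)) = 0 -> root jac s).
Proof.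
move=> sv v0.
rewrite -J'E (_ : _ * (_ * _) = (s%:P - 'X) * ((1 + 'X) ^+ e * v) ^+ 2); last by ring.
apply: (gauss_sign J'pos jac_orth) => //.
  by rewrite mulf_neq0// expf_neq0// onepX_neq0.
rewrite addnC; case: e; rewrite ?expr1 ?expr0 ?mul1r//.
rewrite (leq_trans (size_polyMleq _ _))// [1 + 'X]addrC -[1]/(1%:P).
by rewrite -[1%:P]opprK -polyCN size_XsubC.
Qed.

Lemma strict_form v : (size v <= l - 1)%N -> v != 0 -> 0 < J ((s%:P - 'X) * v ^+ 2).
Proof.
move=> sv v0.
have [p porth] := orth_poly_exists (l - 1) Jpos.
(* A zero z >= s of p would contradict lower_form at u = p / ('X - z). *)
suff zs z : root p z -> z < s.
  have [ge0 eq0] := gauss_sign Jpos porth (fun z pz => ltW (zs z pz)) v0 sv.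
  rewrite lt_neqAle ge0 andbT; apply/eqP => /esym/eq0/zs.
  by rewrite ltxx.
move=> pz; rewrite ltNge; apply/negP => sz.
have /factor_theorem[u pE] := pz; have [sp pE0] := porth.
have u0 : u != 0 by apply/eqP => u0; move: sp; rewrite pE u0 mul0r size_poly0.
have su : size u = (l - 1)%N.
  by move: sp; rewrite pE size_Mmonic ?monicXsubC// size_XsubC addn2/= => -[].
have [+ _] := lower_form (eq_leq su) u0; apply/negP; rewrite -ltNge.
(* From 1 + X = (X - z) + (1 + z) and p = (X - z) u. Under J the first term is at most 0, the second
   strictly negative and the third zero. *)
have -> : (1 + 'X) * ((s%:P - 'X) * u ^+ 2) =
    (s - z) *: ((1 + 'X) * u ^+ 2) - p * p - (1 + z) *: (p * u).
  by rewrite pE -!mul_polyC !polyCB polyCD polyC1; ring.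
rewrite !JB !JZ (pE0 u (eq_leq su)) mulr0 subr0.
have h1 : 0 < J (p * p).
  by rewrite -expr2 pos_sqr// -size_poly_eq0 sp.
have h2 : 0 < J ((1 + 'X) * u ^+ 2).
  apply: Jpos; first by rewrite mulf_neq0 ?onepX_neq0 ?expf_neq0.
  by move=> t /andP[? _]; rewrite hornerM horner_exp mulr_ge0 ?sqr_ge0// !hornerE; lra.
have : (s - z) * J ((1 + 'X) * u ^+ 2) <= 0 by rewrite mulr_le0_ge0 ?subr_le0// ltW.
lra.
Qed.

(** Each claim on the roots of K = F / (X - s) tests J((s - X) K q) = 0 on a cofactor q of K: a
    misplaced or repeated root contradicts [strict_form] or [lower_form]. *)
Lemma lev_nodes_location F : F != 0 -> (size F <= l.+1)%N -> root F s ->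
  (forall q, (size q <= l - 1)%N -> J (F * q) = 0) ->
  exists (c : R) (Y : seq R),
  [/\ c != 0, F = c *: (('X - s%:P) * \prod_(y <- Y) ('X - y%:P)),
      uniq Y /\ size Y = (l - 1)%N,
      forall y, y \in Y -> -1 <= y < s & -1 \in Y -> root jac s].
Proof.
move=> F0 sF rF Forth.
have /factor_theorem[K FE] := rF.
have K0 : K != 0 by apply: contraNneq F0; rewrite FE => ->; rewrite mul0r.
have Korth q : (size q <= l - 1)%N -> J ((s%:P - 'X) * (K * q)) = 0.
  move=> sq; have := Forth q sq; rewrite FE (_ : _ * q = - ((s%:P - 'X) * (K * q))); last by ring.
  by rewrite JN => /eqP; rewrite oppr_eq0 => /eqP.
have sK : size K = l.
  apply/eqP; rewrite eqn_leq; apply/andP; split.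
    by move: sF; rewrite FE size_Mmonic ?monicXsubC// size_XsubC addn2.
  rewrite leqNgt; apply/negP => sKl.
  have sK1 : (size K <= l - 1)%N by lia.
  by have := strict_form sK1 K0; rewrite expr2 Korth// ltxx.
have lK0 : lead_coef K != 0 by rewrite lead_coef_eq0.
(* Orthogonality supplies l - 1 real roots of F, hence at least l - 2 of K, whose degree is l - 1;
   the factor left over is constant or linear, so K splits. *)
have [Y [sY KE]] : exists Y, size Y = (l - 1)%N /\
    K = lead_coef K *: \prod_(y <- Y) ('X - y%:P).
  have [Z [uZ rZ _ sZ]] := orth_roots Jpos F0 Forth.
  have uY0 : uniq (rem s Z) by exact: rem_uniq.
  have rY0 : all (root K) (rem s Z).
    apply/allP => y; rewrite mem_rem_uniq// inE => /andP[ys yZ].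
    by have := allP rZ y yZ; rewrite FE rootM root_XsubC (negPf ys) orbF.
  have sY0 : (l - 2 <= size (rem s Z))%N.
    have [sZ'|sZ'] := boolP (s \in Z); last rewrite rem_id//.
      by rewrite size_rem//; move: sZ; clear; move: (size Z) => k; lia.
    by move: sZ; clear; move: (size Z) => k; lia.
  have sY1 := max_poly_roots K0 rY0 uY0; rewrite sK in sY1.
  have [l1'|l1'] := eqVneq (size (rem s Z)) (l - 1)%N.
    exists (rem s Z); split => //.
    by apply: all_roots_prod_XsubC; rewrite ?uniq_rootsE// sK l1' subn1 prednK.
  have [q qE] : exists q, K = q * \prod_(y <- rem s Z) ('X - y%:P).
    by apply: uniq_roots_prod_XsubC; rewrite ?uniq_rootsE.
  have q0 : q != 0 by apply: contraNneq K0; rewrite qE => ->; rewrite mul0r.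
  have sq : size q = 2.
    move: sK; rewrite qE size_Mmonic ?monic_prod_XsubC// size_prod_XsubC.
    move: l1' sY0 sY1; clear.
    by move: (size q) (size (rem s Z)) => x y; lia.
  have [r rq] : exists r, root q r.
    exists (- (q`_0 / q`_1)); rewrite rootE horner_coef sq !big_ord_recl big_ord0/=.
    rewrite expr0 mulr1 addr0 /bump/= expr1.
    have q1 : q`_1 != 0 by move: q0; rewrite -lead_coef_eq0 lead_coefE sq.
    by apply/eqP; field.
  exists (r :: rem s Z); split.
    by move: l1 l1' sY0 sY1; clear; rewrite /=; move: (size (rem s Z)) => x; lia.
  have qr : q = lead_coef q *: ('X - r%:P).
    have := @all_roots_prod_XsubC _ q [:: r]; rewrite big_seq1; apply.
    - by rewrite sq.
    - by rewrite /= rq.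
    - by rewrite uniq_rootsE.
  rewrite big_cons scalerAl {1}qE; congr (_ * _); rewrite [LHS]qr; congr (_ *: _).
  by rewrite qE lead_coef_Mmonic// monic_prod_XsubC.
have splitY y : y \in Y -> exists v, [/\ v != 0, size v = (l - 1)%N,
    K = ('X - y%:P) * v & v = lead_coef K *: \prod_(y <- rem y Y) ('X - y%:P)].
  move=> yY; set v := lead_coef K *: _.
  have KE' : K = ('X - y%:P) * v.
    by rewrite /v -scalerAr {1}KE (perm_big _ (perm_to_rem yY)) big_cons.
  have v0 : v != 0 by apply: contraNneq K0; rewrite KE' => ->; rewrite mulr0.
  exists v; split => //.
  by move: sK; rewrite {1}KE' mulrC size_Mmonic ?monicXsubC// size_XsubC addn2/= => <-; rewrite subn1.
(* If y >= s then (s - t)(y - t) = (s - t)^2 + (y - s)(s - t) is too positive. *)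
have ys y : y \in Y -> y < s.
  move=> /splitY[v [v0 sv Kv _]]; rewrite ltNge; apply/negP => sy.
  have := Korth v (eq_leq sv); rewrite Kv.
  rewrite (_ : _ * _ = - (((s%:P - 'X) * v) ^+ 2 + (y - s) *: ((s%:P - 'X) * v ^+ 2))); last first.
    by rewrite -mul_polyC polyCB; ring.
  rewrite JN JD JZ => /eqP; rewrite oppr_eq0 gt_eqF//.
  rewrite ltr_pwDl ?mulr_ge0 ?subr_ge0//; last by rewrite ltW// strict_form ?sv.
  by rewrite pos_sqr// mulf_neq0// -opprB oppr_eq0 polyXsubC_eq0.
(* X - y = (1 + X) + (-1 - y): for y <= -1 both parts give nonnegative values with sum 0, which
   forces y = -1 and the equality case of [lower_form]. *)
have yge y : y \in Y -> y <= -1 -> y = -1 /\ root jac s.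
  move=> /splitY[v [v0 sv Kv _]] yle.
  have := Korth v (eq_leq sv); rewrite Kv.
  rewrite (_ : _ * _ = (1 + 'X) * ((s%:P - 'X) * v ^+ 2) +
     (-1 - y) *: ((s%:P - 'X) * v ^+ 2)); last first.
    by rewrite -mul_polyC polyCB polyCN polyC1; ring.
  rewrite JD JZ.
  have [h1 h2] := lower_form (eq_leq sv) v0; have h3 := strict_form (eq_leq sv) v0.
  have h4 : 0 <= (-1 - y) * J ((s%:P - 'X) * v ^+ 2) by rewrite mulr_ge0 ?subr_ge0// ltW.
  move=> h5; have h6 : (-1 - y) * J ((s%:P - 'X) * v ^+ 2) = 0 by lra.
  split; last by apply: h2; lra.
  by move/eqP: h6; rewrite mulf_eq0 (gt_eqF h3) orbF subr_eq0 => /eqP.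
exists (lead_coef K), Y; split => //.
- by rewrite FE {1}KE -scalerAl mulrC.
(* If K = (X - y)^2 u and v = (X - y) u, then J((s - X) v^2) = J((s - X) K u) would be both positive
   and zero. *)
- split => //; apply: uniq_mem_rem => y yY; apply/negP => yY'.
  have [v [v0 sv Kv vE]] := splitY y yY.
  pose u := lead_coef K *: \prod_(y <- rem y (rem y Y)) ('X - y%:P).
  have vu : v = ('X - y%:P) * u.
    by rewrite vE (perm_big _ (perm_to_rem yY')) big_cons -scalerAr.
  have su : (size u <= l - 1)%N.
    rewrite -sv vu; have [->|u0] := eqVneq u 0; first by rewrite size_poly0.
    by rewrite mulrC size_Mmonic ?monicXsubC// size_XsubC addn2/=.
  have := strict_form (eq_leq sv) v0.
  rewrite (_ : _ * _ = (s%:P - 'X) * (K * u)); last by rewrite Kv {1}expr2 {2}vu; ring.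
  by rewrite Korth// ltxx.
- move=> y yY; rewrite ys// andbT leNgt; apply/negP => y1.
  by have [yE _] := yge y yY (ltW y1); rewrite yE ltxx in y1.
- by move=> m1; have [] := yge _ m1 (lexx _).
Qed.

End NodeLocation.

(** * The quadrature formula and its weight at 1 *)

Section LevenshteinQuadrature.
Variables (R : realType) (n : nat) (I : {scalar {poly R}}) (P : nat -> {poly R}).
Hypothesis n2 : (2 <= n)%N.
Hypothesis Ipos : pos_functional I.
Hypothesis I1 : I 1 = 1.
Hypothesis Ider : forall p, I ((1 - 'X ^+ 2) * p^`()) = (n%:R - 1) * I ('X * p).
Hypothesis Porth : forall k, is_orthogonal_poly I k (P k).
Hypothesis P1 : forall k, (P k).[1] = 1.
Variables (l : nat) (e : bool) (s : R).
Hypothesis l1 : (1 <= l)%N.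
Hypothesis s1 : -1 <= s < 1.
Implicit Types (p q f F K : {poly R}).

Let m := (l - 1 + e)%N.
Let U := gegenbauer_kernel P m.
Let UE : (1 - 'X) * U = P m - P m.+1 := gegenbauer_kernelE P1 m.
(** The denominator of L_q without its factor 1 - s; for e = 1 it vanishes at -1 by parity. *)
Let Q : {poly R} := e%:R *: P l + P (l + e).
Let V : {poly R} := (1 + 'X) ^+ e * U.
Let G : {poly R} := Q.[s] *: V - V.[s] *: Q.

(** L_q(n, s) rewritten through U = (P_m - P_(m+1)) / (1 - X). *)
Definition lev_value : R := 'C(n + m - 2, n - 2)%:R *
  (U.[1] - (1 + s) ^+ e * U.[s] / Q.[s]).

Let IZ a p : I (a *: p) = a * I p. Proof. exact: linearZ. Qed.
Let ID p q : I (p + q) = I p + I q. Proof. exact: linearD. Qed.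
Let IB p q : I (p - q) = I p - I q. Proof. exact: linearB. Qed.

Let sm : m.+1 = (l + e)%N.
Proof. by rewrite /m -addSn subn1 prednK. Qed.

Let size_onepXn p k : (size p <= k)%N -> (size ((1 + 'X) ^+ e * p)%R <= k + e)%N.
Proof.
case: e; rewrite ?expr1 ?expr0 ?mul1r ?addn0// => sp.
rewrite (leq_trans (size_polyMleq _ _))// [1 + 'X]addrC -[1]/(1%:P).
by rewrite -[1%:P]opprK -polyCN size_XsubC/= addn1.
Qed.

Let Iorth k q : (size q <= k)%N -> I (P k * q) = 0.
Proof. exact: (Porth k).2. Qed.

Lemma lev_int : I G = Q.[s] * (2 ^+ e * I U).
Proof.
have IV : I V = 2 ^+ e * I U.
  rewrite /V mulrC gegenbauer_kernel_repr//.
    by rewrite horner_exp !hornerE mulrC.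
  have := @size_onepXn 1 1; rewrite size_poly1 mulr1 => /(_ isT) h.
  by rewrite (leq_trans h)// sm addnC addnC leq_add2r.
have IQ : I Q = 0.
  by rewrite /Q ID IZ -[P l]mulr1 -[P (l + e)]mulr1 !Iorth ?size_poly1 ?mulr0 ?addr0// ltn_addr.
by rewrite /G IB !IZ IV IQ mulr0 subr0.
Qed.

Lemma lev_at1 : G.[1] = 2 ^+ e * (Q.[s] * U.[1] - (1 + s) ^+ e * U.[s]).
Proof.
rewrite /G /V /Q !hornerE !P1.
case: e; rewrite /= ?expr0 ?expr1; ring.
Qed.

Lemma lev_int_value : Q.[s] != 0 -> I G * lev_value = G.[1].
Proof.
move=> Qs; have := gegenbauer_kernel_int n2 Ipos I1 Ider Porth P1 m.
rewrite -/U lev_int lev_at1 /lev_value => cU.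
transitivity ((I U * 'C(n + m - 2, n - 2)%:R) *
    (2 ^+ e * (Q.[s] * U.[1] - (1 + s) ^+ e * U.[s]))); last by rewrite cU mul1r.
by field.
Qed.

(** Times 1 - X, the polynomial G combines (1 + X)^e (P_m - P_(m+1)) and (1 - X) Q. For deg q < l -
    1 the cofactors (1 + X)^e q and (1 - X) q have degrees below m and below l, so every P kills its
    cofactor. *)
Lemma lev_quasi_orth : Q.[s] != 0 -> (e -> -1 < s) ->
  exists F, [/\ (1 + 'X) ^+ e * F = G, F != 0, (size F <= l.+1)%N, root F s &
    forall q, (size q <= l - 1)%N -> I ((1 - 'X) * (1 + 'X) ^+ e * (F * q)) = 0].
Proof.
move=> Qs es.
have IU : I U != 0.
  apply/eqP => U0; have := gegenbauer_kernel_int n2 Ipos I1 Ider Porth P1 m.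
  by rewrite -/U U0 mul0r => /esym/eqP; rewrite oner_eq0.
have G0 : G != 0.
  apply/eqP => G0; have := lev_int; rewrite G0 linear0 => /esym/eqP.
  by rewrite !mulf_eq0 (negPf Qs) (negPf IU) orbF expf_eq0 pnatr_eq0 andbF.
have Gs : root G s by rewrite rootE /G hornerD hornerN !hornerZ mulrC subrr.
have [F FG] : exists F, (1 + 'X) ^+ e * F = G.
  have [e1|e0] := boolP e; last by exists G; rewrite expr0 mul1r.
  have : root G (-1).
    have V1 : V.[-1] = 0.
      by rewrite /V e1 expr1 hornerM (_ : (1 + 'X).[-1] = 0) ?mul0r// !hornerE subrr.
    have Q1 : Q.[-1] = 0.
      rewrite /Q e1 scale1r hornerD !(gegenbauer_atN1 n2 Ipos Ider Porth P1).
      by rewrite addn1 exprS mulN1r subrr.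
    by rewrite rootE /G hornerD hornerN !hornerZ V1 Q1 !mulr0 subrr.
  move=> /factor_theorem[F GE]; exists F; rewrite GE mulrC expr1.
  by rewrite polyCN opprK addrC.
have F0 : F != 0 by apply: contraNneq G0; rewrite -FG => ->; rewrite mulr0.
exists F; split => //.
- have sG : (size G <= l.+1 + e)%N.
    rewrite (leq_trans (size_polyD _ _))// size_polyN geq_max; apply/andP; split.
      rewrite (leq_trans (size_scale_leq _ _))// (leq_trans (size_onepXn (leqnn _)))//.
      by rewrite leq_add2r /U (size_gegenbauer_kernel Porth) sm -[l.+1]addn1 leq_add2l leq_b1.
    rewrite (leq_trans (size_scale_leq _ _))// (leq_trans (size_polyD _ _))//.
    rewrite geq_max (Porth (l + e)).1 addSn leqnn andbT.
    by rewrite (leq_trans (size_scale_leq _ _))// (Porth l).1 leq_addr.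
  move: sG; rewrite -FG; case: e; rewrite ?expr0 ?mul1r ?addn0// expr1 mulrC.
  rewrite [1 + 'X]addrC -[1]/(1%:P) -[1%:P]opprK -polyCN.
  by rewrite size_Mmonic ?monicXsubC// size_XsubC addn2 addn1.
- move: Gs; rewrite -FG rootM => /orP[|//].
  case: e es => [es|_]; last by rewrite expr0 (negPf (root1 s)).
  rewrite expr1 rootE !hornerE => /eqP s0.
  by have := es isT; rewrite -subr_gt0 opprK addrC s0 ltxx.
- move=> q sq; rewrite (_ : _ * _ = (1 - 'X) * G * q); last by rewrite -FG; ring.
  have -> : (1 - 'X) * G * q = Q.[s] *: ((P m - P m.+1) * ((1 + 'X) ^+ e * q)) -
      V.[s] *: (Q * ((1 - 'X) * q)).
    by rewrite /G -UE /V -!mul_polyC; ring.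
  have s1q : (size ((1 - 'X) * q)%R <= l)%N.
    rewrite (leq_trans (size_polyMleq _ _))// -opprB size_polyN -[1]/(1%:P) size_XsubC/=.
    by rewrite (leq_ltn_trans sq)// subn1 prednK.
  have seq_ := size_onepXn sq.
  rewrite IB !IZ mulrBl IB !Iorth//; last by rewrite leqW.
  rewrite subrr mulr0 sub0r /Q mulrDl ID -scalerAl IZ !Iorth// ?mulr0 ?addr0 ?mulr0 ?oppr0//.
  by rewrite (leq_trans s1q)// leq_addr.
Qed.

Variables (J J' : {scalar {poly R}}) (jac : {poly R}).
Hypothesis JE : forall p, J p = I ((1 - 'X) * (1 + 'X) ^+ e * p).
Hypothesis J'E : forall p, J' p = I ((1 - 'X) * (1 + 'X) ^+ (~~ e) * p).
Hypothesis jac_orth : is_orthogonal_poly J' m jac.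
Hypothesis jac_le : forall z, root jac z -> z <= s.
Hypothesis es1 : e -> -1 < s.
Hypothesis Qs : Q.[s] != 0.
Hypothesis Us : e -> U.[s] != 0.

Let weight_pos (b : bool) : pos_functional (weighted I ((1 - 'X) * (1 + 'X) ^+ b)).
Proof.
apply: pos_weighted => //; first by rewrite mulf_neq0 ?onemX_neq0// expf_neq0 ?onepX_neq0.
move=> t /andP[? ?]; rewrite hornerM horner_exp mulr_ge0 ?exprn_ge0// !hornerE; lra.
Qed.

Lemma lev_nodes_exist : exists (Y : seq R) (K : {poly R}) (c : R),
  let A := (if e then [:: -1] else [::]) ++ s :: Y in
  [/\ size Y = (l - 1)%N, uniq (1 :: A), forall z, z \in A -> -1 <= z <= s,
     [/\ c != 0, K = c *: \prod_(y <- Y) ('X - y%:P) &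
       forall p, (size p <= l)%N -> J (K * p) = p.[s]]
   & forall f, (size f <= l + l + e)%N -> I f = f.[1] / lev_value +
       \sum_(z <- A) f.[z] *
         ((I (node_poly A z) - (node_poly A z).[1] / lev_value) / (node_poly A z).[z])].
Proof.
have Jpos : pos_functional J by move=> p p0 pge; rewrite JE; exact: weight_pos.
have J'pos : pos_functional J' by move=> p p0 pge; rewrite J'E; exact: weight_pos.
have [sN1 slt1] := andP s1.
have [F [FG F0 sF rF Forth]] := lev_quasi_orth Qs es1.
have JF q : (size q <= l - 1)%N -> J (F * q) = 0 by move=> sq; rewrite JE Forth.
have JJ' v : J' ((1 + 'X) ^+ e * ((1 + 'X) ^+ e * v)) = J ((1 + 'X) * v).
  by rewrite J'E JE; congr (I _); case: e; rewrite /= ?expr0 ?expr1; ring.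
have [c0 [Y [c00 FE [uY sY] Ylt Ym1]]] :=
  lev_nodes_location Jpos J'pos JJ' l1 sN1 jac_orth jac_le F0 sF rF JF.
(* For e = 1, U is a multiple of [jac], so U(s) != 0 rules out the case in which Y repeats the fixed
   node -1. *)
have eY : e -> -1 \notin Y.
  move=> e1; apply/negP => /Ym1 js; have := Us e1; rewrite -[_ != 0]negbK => /negP; apply.
  have [d jE] : exists d, U = d *: jac.
    apply: (orth_poly_unique J'pos jac_orth).
      by rewrite /U (size_gegenbauer_kernel Porth).
    move=> q sq; rewrite J'E e1 /= expr0 mulr1.
    exact: (gegenbauer_kernel_orth Porth P1 m).2.
  by rewrite negbK -rootE jE rootE hornerZ (eqP js) mulr0.
pose A := (if e then [:: -1] else [::]) ++ s :: Y.
have Aprod : \prod_(z <- A) ('X - z%:P) = (1 + 'X) ^+ e * (('X - s%:P) * \prod_(y <- Y) ('X - y%:P)) :> {poly R}.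
  rewrite /A big_cat big_cons /=; congr (_ * _).
  case: e; rewrite ?big_nil ?expr0// big_seq1 expr1 polyCN opprK addrC//.
have memA z : z \in A -> (e /\ z = -1) \/ z = s \/ z \in Y.
  rewrite /A mem_cat inE => /or3P[|/eqP ->|zY]; [|by right; left|by right; right].
  by case: e => //=; rewrite inE => /eqP ->; left.
have Ale z : z \in A -> -1 <= z <= s.
  move=> /memA[[_ ->]|[->|/Ylt/andP[-> /ltW ->]//]]; first by rewrite lexx.
  by rewrite lexx andbT.
have uA : uniq (1 :: A).
  rewrite cons_uniq; apply/andP; split.
    by apply/negP => /Ale/andP[_]; rewrite leNgt slt1.
  rewrite /A cat_uniq cons_uniq uY andbT; apply/and3P; split.
  - by case: e.
  - apply/hasPn => y ysY; move: eY es1; case: e => // eY' es1'; rewrite mem_seq1.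
    move: ysY; rewrite inE => /orP[/eqP ->|yY]; first by rewrite gt_eqF// es1'.
    by apply: contraNneq (eY' isT) => <-.
  - by apply/negP => /Ylt; rewrite ltxx andbF.
pose H := c0 *: \prod_(y <- Y) ('X - y%:P) : {poly R}.
have FH : F = ('X - s%:P) * H by rewrite FE /H scalerAr.
(* H represents evaluation at s up to the factor J H; rescaled, it is the reproducing kernel. *)
have Hrep p : (size p <= l)%N -> J (H * p) = p.[s] * J H.
  move=> sp; have /factor_theorem[q qE] : root (p - p.[s]%:P) s.
    by rewrite rootE !hornerE subrr.
  have sq : (size q <= l - 1)%N.
    have [->|q0] := eqVneq q 0; first by rewrite size_poly0.
    have : (size (p - p.[s]%:P)%R <= l)%N.
      rewrite (leq_trans (size_polyD _ _))// geq_max sp size_polyN.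
      by rewrite (leq_trans (size_polyC_leq1 _)).
    rewrite qE size_Mmonic ?monicXsubC// size_XsubC addn2/=.
    by move: l1; clear; move: (size q) => k; lia.
  have -> : H * p = p.[s] *: H + F * q.
    by rewrite -{1}[p](subrK p.[s]%:P) qE FH -mul_polyC; ring.
  by rewrite linearD /= JF// addr0 linearZ.
have H0 : H != 0 by rewrite /H scale_poly_eq0 negb_or c00 monic_neq0 ?monic_prod_XsubC.
have sH : (size H <= l)%N by rewrite size_scale// size_prod_XsubC sY subn1 prednK.
have JH : J H != 0.
  apply/eqP => JH0; have := pos_sqr Jpos H0.
  by rewrite expr2 Hrep// JH0 mulr0 ltxx.
exists Y, ((J H)^-1 *: H), (c0 / J H); split => //.
  split; first by rewrite mulf_neq0 ?invr_eq0.
    by rewrite /H scalerA mulrC.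
  by move=> p sp; rewrite -scalerAl linearZ/= Hrep// mulrCA mulVf ?mulr1.
move=> f sf.
(* Together with 1 there are l + e + 1 nodes, and orthogonality holds for l - 1 coefficients:
   exactness up to degree 2 l - 1 + e. *)
have quadI f' : (size f' <= l + l + e)%N -> I f' = \sum_(z <- 1 :: A) f'.[z] *
   (I (node_poly (1 :: A) z) / (node_poly (1 :: A) z).[z]).
  move=> sf'; apply: (quadrature (m := l - 1)) => //.
    move=> q sq; rewrite big_cons Aprod.
    rewrite (_ : _ * q = (- c0^-1) *: ((1 - 'X) * (1 + 'X) ^+ e * (F * q))).
      by rewrite IZ Forth ?mulr0.
    rewrite FE -!scalerAl -scalerAr scalerA mulNr mulVf// scaleN1r polyC1; ring.
  rewrite (leq_trans sf')// /= size_cat /= sY.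
  by move: l1; clear; case: e => /=; lia.
set a := fun z => I (node_poly (1 :: A) z) / (node_poly (1 :: A) z).[z].
have GA z : z \in A -> G.[z] = 0.
  move=> zA; apply/eqP; rewrite -rootE -FG FE -scalerAr -Aprod rootE hornerZ mulf_eq0.
  by rewrite -[X in _ || X]rootE root_prod_XsubC zA orbT.
have G1 : G.[1] != 0.
  rewrite -FG FE -scalerAr -Aprod hornerZ mulf_neq0//.
  by rewrite -rootE root_prod_XsubC; move: uA; rewrite cons_uniq => /andP[].
have IG0 : I G = G.[1] * a 1.
  rewrite quadI; last first.
    by rewrite -FG (leq_trans (size_onepXn sF))// leq_add2r -[l.+1]addn1 leq_add2l.
  rewrite big_cons big1_seq ?addr0// => z /andP[_ zA].
  by rewrite GA// mul0r.
(* G vanishes at all nodes but 1, so its integral over G(1) is the weight there. *)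
have a1 : a 1 = lev_value^-1.
  have := lev_int_value Qs; rewrite IG0 -mulrA => GE.
  have aL : a 1 * lev_value = 1 by apply: (mulfI G1); rewrite mulr1.
  have L0 : lev_value != 0 by apply: contra_eq_neq aL => ->; rewrite mulr0 eq_sym oner_eq0.
  by apply: (mulIf L0); rewrite mulVf.
rewrite quadI// big_cons -/(a 1) a1; congr (_ + _); apply: eq_big_seq => z zA.
congr (_ * _); rewrite -/(a z).
have sA : size A = (l + e)%N by rewrite /A size_cat /= sY; move: l1; clear; case: e => /=; lia.
have snp : (size (node_poly A z) <= l + l + e)%N.
  by rewrite (leq_trans (size_node_poly zA))// sA leq_add2r leq_addr.
(* Testing on [node_poly A z] leaves only the nodes 1 and z, whence the defining formula of rho. *)
rewrite (quadI _ snp) big_cons -/(a 1) a1 addrC addKr (bigD1_seq z)//=; last first.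
  by move: uA; rewrite cons_uniq => /andP[].
rewrite big1_seq ?addr0; last first.
  by move=> y /andP[yz yA]; rewrite node_poly_eq0// mul0r.
by rewrite -/(a z) mulrC mulKf// node_poly_neq0.
Qed.

End LevenshteinQuadrature.

(** * Hermite interpolation *)

Section HermiteInterpolation.
Variable R : realType.
Implicit Types (p q g : {poly R}) (A B : seq R) (f phi dphi : R -> R).

(** Since w vanishes on A, adding w r keeps the values and changes the derivative at b by w'(b)
    r(b), where w'(b) != 0 as the roots of w are simple. *)
Lemma hermite_exists A B (u v : R -> R) : uniq A -> uniq B -> {subset B <= A} ->
  exists g, [/\ (size g <= size A + size B)%N, forall a, a \in A -> g.[a] = u a &
    forall b, b \in B -> g^`().[b] = v b].
Proof.
move=> uA uB BA; pose w : {poly R} := \prod_(a <- A) ('X - a%:P).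
pose g0 := interpolant A u.
pose r := interpolant B (fun b => (v b - g0^`().[b]) / w^`().[b]).
have w0 a : a \in A -> w.[a] = 0.
  by move=> aA; apply/eqP; rewrite -rootE root_prod_XsubC.
have dw b : b \in B -> w^`().[b] != 0.
  move=> bB; have bA := BA b bB.
  rewrite /w (perm_big _ (perm_to_rem bA)) big_cons derivM derivXsubC mul1r.
  rewrite hornerD hornerM hornerXsubC subrr mul0r addr0 -rootE root_prod_XsubC.
  by rewrite mem_rem_uniqF.
exists (g0 + w * r); split.
- rewrite (leq_trans (size_polyD _ _))// geq_max; apply/andP; split.
    by rewrite (leq_trans (size_interpolant _ _))// leq_addr.
  rewrite (leq_trans (size_polyMleq _ _))// size_prod_XsubC/= leq_add2l.
  exact: size_interpolant.
- by move=> a aA; rewrite hornerD hornerM w0// mul0r addr0 horner_interpolant.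
- move=> b bB; rewrite derivD derivM hornerD hornerD !hornerM w0 ?BA// mul0r addr0.
  rewrite horner_interpolant// mulrC divfK ?dw//; ring.
Qed.

(** Rolle's theorem enters as a hypothesis because the derivatives used later are relative to [-1,
    1[. The new zeros avoid the old ones, so zeros of [dphi] at double nodes can be added without
    repetition. *)
Lemma rolle_path phi dphi (y : R) (s : seq R) :
  (forall a b, y <= a -> a < b -> b <= last y s -> phi a = 0 -> phi b = 0 ->
     exists2 c, a < c < b & dphi c = 0) ->
  path <%R y s -> {in y :: s, forall z, phi z = 0} ->
  exists C, [/\ size C = size s, path <%R y C &
    forall c, c \in C -> [/\ y < c < last y s, dphi c = 0 & c \notin y :: s]].
Proof.
elim: s y => [|z s IH] y rolle /=; first by exists [::].
move=> /andP[yz zs] z0.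
have zle x : x \in z :: s -> z <= x.
  rewrite inE => /predU1P[->//|xs]; apply/ltW.
  exact: (allP (order_path_min lt_trans zs)).
have zlast : z <= last z s by apply: zle; exact: mem_last.
have rz a b : z <= a -> a < b -> b <= last z s -> phi a = 0 -> phi b = 0 ->
    exists2 c, a < c < b & dphi c = 0.
  by move=> za ab bl; apply: rolle => //; exact: le_trans (ltW yz) za.
have [|C [sC pC CP]] := IH z rz zs.
  by move=> x xs; apply: z0; rewrite inE xs orbT.
have [||c /andP[yc cz] c0] := rolle y z (lexx _) yz zlast.
- by apply: z0; rewrite mem_head.
- by apply: z0; rewrite !inE eqxx orbT.
exists (c :: C); split; first by rewrite /= sC.
  rewrite /= yc/=; case: C pC {sC CP} => //= d C /andP[zd ->]; rewrite andbT.
  exact: lt_trans zd.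
move=> x; rewrite inE => /predU1P[->|xC].
  split => //; first by rewrite yc (lt_le_trans cz).
  rewrite inE negb_or gt_eqF//=; apply/negP => /zle.
  by rewrite leNgt cz.
have [/andP[zx xl] x0 xn] := CP x xC; split => //; first by rewrite (lt_trans yz zx).
by rewrite inE negb_or xn andbT gt_eqF// (lt_trans yz).
Qed.

Definition rolle_on (a b : R) phi dphi : Prop :=
  forall x y, a <= x -> x < y -> y <= b -> phi x = 0 -> phi y = 0 ->
    exists2 c, x < c < y & dphi c = 0.

Definition zeros_on (a b : R) phi (Z : seq R) : Prop :=
  uniq Z /\ forall z, z \in Z -> a <= z <= b /\ phi z = 0.

Lemma rolle_zeros a b phi dphi Z : rolle_on a b phi dphi -> zeros_on a b phi Z ->
  exists C, [/\ zeros_on a b dphi C, size C = (size Z).-1 & forall c, c \in C -> c \notin Z].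
Proof.
move=> rolle [uZ Z0]; have := sort_lt_sorted Z; rewrite uZ.
have memS : sort <=%R Z =i Z by move=> x; rewrite mem_sort.
have := size_sort <=%R Z; case: (sort _ _) memS => [|y s] memS /= sZ ps.
  by exists [::]; split; rewrite -?sZ //; split.
have inZ z : z \in y :: s -> a <= z <= b /\ phi z = 0 by rewrite memS; exact: Z0.
have [/andP[ay _] _] := inZ y (mem_head _ _).
have [/andP[_ lb] _] := inZ _ (mem_last y s).
have [|||C [sC pC CP]] := @rolle_path phi dphi y s.
- move=> x x' yx xx' xl; apply: rolle => //; first exact: le_trans yx.
  exact: le_trans lb.
- by [].
- by move=> z /inZ[].
exists C; split; last by move=> c /CP[_ _]; rewrite memS.
- split; first by have /= := sorted_uniq lt_trans ltxx (path_sorted pC).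
  move=> c /CP[/andP[yc cl] c0 _]; split => //.
  by rewrite (le_trans ay (ltW yc)) (le_trans (ltW cl) lb).
- by rewrite sC -sZ.
Qed.

Lemma iterated_rolle a b (phi : nat -> R -> R) (i k : nat) Z :
  (forall j, (i <= j < i + k)%N -> rolle_on a b (phi j) (phi j.+1)) ->
  zeros_on a b (phi i) Z -> size Z = k.+1 ->
  exists2 x, a <= x <= b & phi (i + k)%N x = 0.
Proof.
elim: k i Z => [|k IH] i Z rolle Z0 sZ.
  rewrite addn0; case: Z sZ Z0 => // z Z _ [_ /(_ z (mem_head _ _))[zab z0]].
  by exists z.
have [|C [C0 sC _]] := @rolle_zeros a b (phi i) (phi i.+1) Z _ Z0.
  by apply: rolle; rewrite leqnn/= addnS ltnS leq_addr.
rewrite -addSnnS; apply: (IH _ C) => //; last by rewrite sC sZ.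
by move=> j /andP[ij jk]; apply: rolle; rewrite ltnW//= addnS -addSn.
Qed.

End HermiteInterpolation.

(** * Derivatives relative to [-1, 1[ *)

Section WithinDerivative.
Variable R : realType.
Notation D := (`[-1, 1[%classic : set R).
Implicit Types (f F : R -> R) (t x : R).

Let inD t : -1 <= t < 1 -> D t.
Proof. by rewrite /= in_itv. Qed.

(** Covers t = -1, where the derivative is one-sided: Rolle's theorem needs continuity there, but
    two-sided derivatives only inside. *)
Lemma within_derivable_continuous F t : derivable_within D F t ->
  F u @[u --> within D (nbhs t)] --> F t.
Proof.
move=> dF; apply/cvgrPdist_lt => eps eps0.
have cq : (F u - F t) @[u --> within D (dnbhs t)] --> (0 : R).
  have : ((F u - F t) / (u - t)) * (u - t) @[u --> within D (dnbhs t)] -->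
      derive_within D F t * 0.
    apply: cvgM; first exact: dF.
    rewrite -[X in _ --> X](subrr t); apply: cvgB; last exact: cvg_cst.
    apply: cvg_trans (cvg_within _) _; exact: cvg_within.
  rewrite mulr0; apply: cvg_trans; apply: near_eq_cvg.
  rewrite near_withinE; near=> u => _; rewrite divfK// subr_eq0.
  by near: u; exact: nbhs_dnbhs_neq.
have /cvgrPdist_lt/(_ _ eps0) := cq.
rewrite !near_withinE /dnbhs; apply: filterS => u h Du.
have [->|ut] := eqVneq u t; first by rewrite subrr normr0.
by have := h ut Du; rewrite sub0r normrN distrC.
Unshelve. all: by end_near. Qed.

Lemma within_is_derive F t : -1 < t < 1 -> derivable_within D F t ->
  is_derive t 1 F (derive_within D F t).
Proof.
move=> /andP[t0 t1] dF; apply/is_derive1_caratheodory.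
exists (fun u => if u == t then derive_within D F t else (F u - F t) / (u - t)).
split; last by rewrite eqxx.
  move=> u; have [->|ut] := eqVneq u t; first by rewrite !subrr mulr0.
  by rewrite divfK// subr_eq0.
apply/continuous_withinNx; rewrite eqxx.
have cq : (F u - F t) / (u - t) @[u --> within D (dnbhs t)] --> derive_within D F t.
  exact: dF.
have Dt : \forall u \near t, D u.
  have : t \in `](-1), 1[ by rewrite in_itv/= t0.
  move=> /near_in_itvoo; apply: filterS => u; rewrite in_itv/= => /andP[u0 u1].
  by apply: inD; rewrite ltW.
apply/cvgrPdist_lt => eps eps0.
have /cvgrPdist_lt/(_ _ eps0) := cq.
rewrite near_withinE /dnbhs !near_withinE; apply: filterS2 Dt => u Du h ut.
by rewrite /= (negPf ut); exact: h.
Qed.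

End WithinDerivative.

(** * The sign of the Hermite interpolation error *)

Section InterpolationInequality.
Variables (R : realType) (f : R -> R) (k : nat).
Notation D := (`[-1, 1[%classic : set R).
Local Notation F j := (derive_n_within D j f).
Hypothesis fder : forall j t, (j < k.+1)%N -> -1 <= t < 1 -> derivable_within D (F j) t.
Hypothesis fge0 : forall t, -1 <= t < 1 -> 0 <= F k.+1 t.
Implicit Types (p g : {poly R}) (A B : seq R).

Lemma rolle_diff (p : {poly R}) (s : R) (j : nat) : s < 1 -> (j < k.+1)%N ->
  rolle_on (-1) s (fun t => F j t - p^`(j).[t]) (fun t => F j.+1 t - p^`(j.+1).[t]).
Proof.
move=> s1 jk x y x0 xy ys fx fy.
have inD t : x <= t <= y -> -1 <= t < 1.
  move=> /andP[xt ty]; rewrite (le_trans x0 xt)/=.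
  by rewrite (le_lt_trans ty)// (le_lt_trans ys).
have der t : t \in `]x, y[ ->
    is_derive t 1 (fun t => F j t - p^`(j).[t]) (F j.+1 t - p^`(j.+1).[t]).
  rewrite in_itv/= => /andP[xt ty].
  have tD : -1 < t < 1.
    by rewrite (le_lt_trans x0 xt)/= (lt_le_trans ty)// (le_trans ys)// ltW.
  have tx : x <= t <= y by rewrite !ltW.
  have d1 := within_is_derive tD (fder jk (inD t tx)).
  apply: (is_derive_eq (is_deriveB d1 (is_derive_poly p^`(j) t))).
  by rewrite -derivnS.
have [|||c cxy dc] := @Rolle R (fun t => F j t - p^`(j).[t]) x y xy.
- by move=> t /der[].
- apply/subspace_continuousP => t; rewrite /= in_itv/= => txy.
  apply: cvgB; last first.
    by apply: cvg_trans (@continuous_horner R p^`(j) t); apply: cvg_app; exact: cvg_within.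
  have := within_derivable_continuous (fder jk (inD t txy)).
  apply: cvg_trans; apply: cvg_app; apply: within_subset => u.
  by rewrite /= !in_itv/=; exact: inD.
- by rewrite fx fy.
exists c; first by move: cxy; rewrite in_itv.
by have := der c cxy; have := dc => [[_ <-]] [_ <-].
Qed.

Lemma derivn_monic p m : p \is monic -> size p = m.+1 -> p^`(m) = m`!%:R%:P.
Proof.
move=> mp sp; rewrite -[p](subrK 'X^m) derivnD derivn_poly0 ?add0r.
  by rewrite derivnXn subnn expr0 ffactnn -polyC_natr.
apply/leq_sizeP => j; rewrite leq_eqVlt => /predU1P[<-|mj].
  by rewrite coefB coefXn eqxx; move/monicP: mp; rewrite lead_coefE sp => ->; rewrite subrr.
by rewrite coefB coefXn gtn_eqF// nth_default ?subrr// sp.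
Qed.

(** With w the node polynomial, f - g - c w vanishes on A and at x; its derivative vanishes at
    [size A] intermediate points and on B, that is k + 1 points. After k more Rolle steps the
    derivative of f of order k + 1 equals c (k + 1)! somewhere, so c >= 0 and f(x) - g(x) = c w(x)
    <= 0. *)
Lemma hermite_upper_bound A B g (s : R) : uniq A -> uniq B -> {subset B <= A} ->
  s < 1 -> (forall a, a \in A -> -1 <= a <= s) ->
  (size A + size B = k.+1)%N -> (size g <= k.+1)%N ->
  (forall a, a \in A -> g.[a] = f a) ->
  (forall b, b \in B -> g^`().[b] = F 1 b) ->
  forall x, -1 <= x <= s ->
  (\prod_(a <- A) ('X - a%:P) * \prod_(b <- B) ('X - b%:P)).[x] <= 0 ->
  f x <= g.[x].
Proof.
move=> uA uB BA s1 As sAB sg gA gB x xs wx.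
set w := _ * _ in wx.
have [xA|xA] := boolP (x \in A); first by rewrite gA.
have wm : w \is monic by rewrite monicMl ?monic_prod_XsubC.
have sw : size w = k.+2.
  by rewrite /w size_Mmonic ?monic_prod_XsubC ?monic_neq0 ?monic_prod_XsubC// !size_prod_XsubC addnS/= addSn sAB.
have rootw z : (w.[z] == 0) = (z \in A).
  rewrite -rootE /w rootM !root_prod_XsubC; apply/idP/idP; last by move->.
  by move=> /orP[//|/BA].
have wx0 : w.[x] != 0 by rewrite rootw.
(* With this c the error f - g - c w has one more zero, at x. *)
pose c := (f x - g.[x]) / w.[x].
pose p := g + c *: w.
have phi0 z : z \in x :: A -> f z - p.[z] = 0.
  rewrite inE => /predU1P[->|zA].
    by rewrite /p hornerD hornerZ /c divfK// subrKC subrr.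
  have wz : w.[z] = 0 by apply/eqP; rewrite rootw.
  by rewrite /p hornerD hornerZ wz mulr0 addr0 gA// subrr.
have Z0 : zeros_on (-1) s (fun t => F 0 t - p^`(0).[t]) (x :: A).
  split; first by rewrite /= xA.
  move=> z zA; split; last by rewrite derivn0 phi0.
  by move: zA; rewrite inE => /predU1P[->|/As].
have [C [[uC C0] sC CA]] := rolle_zeros (@rolle_diff p s 0 s1 (ltn0Sn k)) Z0.
have Z1 : zeros_on (-1) s (fun t => F 1 t - p^`(1).[t]) (C ++ B).
  split.
    rewrite cat_uniq uC uB andbT; apply/hasPn => b bB; apply/negP => bC.
    by have := CA b bC; rewrite inE (BA b bB) orbT.
  move=> z; rewrite mem_cat => /orP[/C0//|zB]; split; first exact/As/BA.
  have dw : w^`().[z] = 0.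
    rewrite /w derivM hornerD !hornerM.
    have /eqP -> : (\prod_(b <- B) ('X - b%:P)).[z] == 0 by rewrite -rootE root_prod_XsubC.
    have /eqP -> : (\prod_(b <- A) ('X - b%:P)).[z] == 0 by rewrite -rootE root_prod_XsubC BA.
    by rewrite mulr0 mul0r addr0.
  by rewrite derivn1 /p derivD derivZ hornerD hornerZ dw mulr0 addr0 gB// subrr.
have sZ1 : size (C ++ B) = k.+1 by rewrite size_cat sC.
have [|xi xis] := iterated_rolle (a := -1) (b := s) (phi := fun j t => F j t - p^`(j).[t])
    (i := 1) (k := k) _ Z1 sZ1.
  by move=> j /andP[_ jk]; apply: rolle_diff.
rewrite add1n.
have -> : p^`(k.+1) = (c * k.+1`!%:R)%:P.
  by rewrite /p derivnD derivnZ derivn_poly0// add0r (derivn_monic wm sw) -mul_polyC -polyCM.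
rewrite hornerC => /eqP; rewrite subr_eq0 => /eqP Fc.
have : 0 <= c * k.+1`!%:R.
  rewrite -Fc; apply: fge0; move/andP: xis => [-> xs']; exact: le_lt_trans s1.
rewrite pmulr_lge0 ?ltr0n ?fact_gt0// => c0.
have : f x - g.[x] <= 0.
  rewrite -(divfK wx0 (f x - g.[x])) -/c; exact: mulr_ge0_le0.
by rewrite subr_le0.
Qed.

End InterpolationInequality.

(** * The energy bound *)

Section Instances.
Variables (R : realType) (n : nat).
Hypothesis n2 : (2 <= n)%N.
Implicit Types (p q : {poly R}) (k l : nat) (e : bool) (s : R).

(** Linearity rests on integrability, available for n >= 2; hence an existential rather than a
    canonical instance. *)
Lemma mu_int_scalar : exists I : {scalar {poly R}}, (I : {poly R} -> R) = mu_int n.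
Proof.
have lin : scalar (mu_int n : {poly R} -> R).
  by move=> a p q; rewrite !mu_intE// sphere_intP//; ring.
pose mix := GRing.isLinear.Build R {poly R} R *%R (mu_int n) lin.
by exists (HB.pack (mu_int n : {poly R} -> R) mix : {scalar {poly R}}).
Qed.

Lemma mu_int_pos : pos_functional (mu_int n : {poly R} -> R).
Proof.
move=> p p0 pge; rewrite mu_intE// mulr_gt0 ?gegenbauer_const_gt0//.
exact: sphere_int_gt0.
Qed.

Lemma mu_int_deriv p : mu_int n ((1 - 'X ^+ 2) * p^`()) = (n%:R - 1) * mu_int n ('X * p).
Proof. by rewrite !mu_intE// sphere_int_deriv// mulrCA. Qed.

Lemma gegenbauer_spec k :
  is_orthogonal_poly (mu_int n) k (gegenbauer R n k) /\ (gegenbauer R n k).[1] = 1.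
Proof.
have [I IE] := mu_int_scalar.
have Ipos : pos_functional I by rewrite IE; exact: mu_int_pos.
have := @orth_poly_normalized _ I k 1 Ipos (oner_neq0 _); rewrite IE.
by move=> /(xgetPex (0 : {poly R})).
Qed.

(** The Jacobi weight is (1 - t)(1 + t)^b dmu up to a constant, which does not affect orthogonality.
    The prescribed value at 1 is nonzero, so the polynomial exists. *)
Lemma jacobi_spec (I : {scalar {poly R}}) (b : bool) k :
  (I : {poly R} -> R) = mu_int n ->
  is_orthogonal_poly (weighted I ((1 - 'X) * (1 + 'X) ^+ b)) k
    (jacobi (true%:R + (n%:R - 3) / 2) (b%:R + (n%:R - 3) / 2) k).
Proof.
move=> IE; have g0 := gegenbauer_const_gt0 R n2.
have wE p : weighted I ((1 - 'X) * (1 + 'X) ^+ b) p = gegenbauer_const R n *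
    jacobi_int (true%:R + (n%:R - 3) / 2) (b%:R + (n%:R - 3) / 2) p.
  by rewrite /weighted IE mu_intE// jacobi_intE// expr1.
have orthE p : is_orthogonal_poly (weighted I ((1 - 'X) * (1 + 'X) ^+ b)) k p <->
    is_orthogonal_poly (jacobi_int (true%:R + (n%:R - 3) / 2) (b%:R + (n%:R - 3) / 2)) k p.
  split=> -[sp po]; split=> // q sq; have := po q sq; rewrite wE.
    by move=> /eqP; rewrite mulf_eq0 (gt_eqF g0) => /eqP.
  by move=> ->; rewrite mulr0.
have Jpos : pos_functional (weighted I ((1 - 'X) * (1 + 'X) ^+ b)).
  apply: pos_weighted; first by rewrite IE; exact: mu_int_pos.
    by rewrite mulf_neq0 ?onemX_neq0// expf_neq0 ?onepX_neq0.
  move=> t /andP[? ?]; rewrite hornerM horner_exp mulr_ge0 ?exprn_ge0// !hornerE; lra.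
apply/orthE.
have y0 : \prod_(i < k) ((true%:R + (n%:R - 3) / 2 + i.+1%:R) / i.+1%:R) != 0 :> R.
  apply/prodf_neq0 => i _; rewrite mulf_neq0 ?invr_eq0 ?pnatr_eq0// gt_eqF//.
  rewrite -natr1; have := ler0n R i; have : 2 <= n%:R :> R by rewrite ler_nat.
  by rewrite /=; lra.
have [p [/orthE po p1]] := @orth_poly_normalized _ _ k _ Jpos y0.
rewrite /jacobi; case: xgetP => [q _ [] //|/(_ p)]; by case.
Qed.

(** For k = 0 the polynomial is a nonzero constant and has no root; otherwise [rootsR] is increasing
    and its last element is the largest zero. *)
Lemma jacobi_top_ge (I : {scalar {poly R}}) (b : bool) k s z :
  (I : {poly R} -> R) = mu_int n ->
  jacobi_top R n true b k <= s ->
  root (jacobi (true%:R + (n%:R - 3) / 2) (b%:R + (n%:R - 3) / 2) k) z -> z <= s.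
Proof.
move=> IE; have [sp _] := jacobi_spec b k IE; set jac := jacobi _ _ _ in sp *.
case: k @jac sp => [|k] jac sp /=.
  move: sp => /eqP/size_poly1P[c c0 ->] _.
  by rewrite rootC (negPf c0).
rewrite -/jac => tops rz; apply: le_trans tops.
have jac0 : jac != 0 by rewrite -size_poly_eq0 sp.
have : z \in rootsR jac by rewrite mem_rootsR.
have : sorted <=%R (rootsR jac) by apply: sub_sorted (sorted_roots _ _ _) => x y /ltW.
elim/last_ind: (rootsR jac) => // r x _.
rewrite last_rcons mem_rcons inE => sr /predU1P[->//|zr].
move: sr; rewrite -rev_sorted rev_rcons /= => /(order_path_min (rev_trans le_trans)).
by move=> /allP; apply; rewrite mem_rev.
Qed.

End Instances.

Lemma mul_binS m k : (m.+1 * 'C(m + k.+1, m.+1) = (m + k.+1) * 'C(m + k, m))%N.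
Proof. by have := mul_bin_diag (m + k.+1) m; rewrite addnS /= => ->. Qed.

Lemma mul_bin_same m k : (m.+1 * 'C(m + k, m.+1) = k * 'C(m + k, m))%N.
Proof. by have := mul_bin_left (m + k) m; rewrite addKn. Qed.

(** Divided by n - 1, the left side is what [lev_value] becomes when its fraction vanishes. *)
Lemma lev_D_bound (n l : nat) (e : bool) : (2 <= n)%N -> (1 <= l)%N ->
  ('C(n + (l - 1 + e) - 2, n - 2) * (2 * (l - 1 + e) + n - 1) <=
   lev_D n (2 * l - 1 + e) * (n - 1))%N.
Proof.
case: n => [|[|m]] // _; case: l => // l _.
rewrite /lev_D lev_lE// lev_eE// subn1 /= !addSn !subSS !subn0 addnS subSS subn0 [in X in (_ <= X)%N]mulnC.
case: e; rewrite ?addn1 ?addn0 [(m.+1 * _)%N]mulnDr.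
- rewrite -(addnS m l.+1) mul_binS mul_bin_same -mulnDl mulnC leq_mul2r; apply/orP; right; lia.
- rewrite !mul_binS -mulnDl mulnC leq_mul2r; apply/orP; right; lia.
Qed.

(** * Identification of the Levenshtein function, kernel and roots *)

Section LevenshteinData.
Variables (R : realType) (n l : nat) (e : bool) (s : R).
Hypothesis n2 : (2 <= n)%N.
Hypothesis l1 : (1 <= l)%N.
Hypothesis s1 : -1 <= s < 1.
Local Notation tau := (2 * l - 1 + e)%N.
Local Notation P := (gegenbauer R n).
Local Notation m := (l - 1 + e)%N.
Local Notation Q := (e%:R *: P l + P (l + e)).
Implicit Types (p q : {poly R}).

Let castE (k : nat) : (2 * k + n - 1)%:R = 2 * k%:R + n%:R - 1 :> R.
Proof.
rewrite natrB; first by rewrite natrD natrM.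
by rewrite (leq_trans (ltnW n2))// leq_addl.
Qed.

Let P1 k : (P k).[1] = 1 := (gegenbauer_spec R n2 k).2.

Lemma lev_LE : lev_L n tau s = lev_value n P l e s.
Proof.
have [I IE] := mu_int_scalar R n2.
have Porth k : is_orthogonal_poly I k (P k) by rewrite IE; exact: (gegenbauer_spec R n2 k).1.
have Ipos : pos_functional I by rewrite IE; exact: mu_int_pos.
have Ider p : I ((1 - 'X ^+ 2) * p^`()) = (n%:R - 1) * I ('X * p).
  by rewrite IE mu_int_deriv.
rewrite /lev_L lev_lE// lev_eE// /lev_value.
rewrite (gegenbauer_kernel_at1 n2 Ipos Ider Porth P1).
have US : (P m - P (l + e)).[s] = (1 - s) * (gegenbauer_kernel P m).[s].
  have := congr1 (horner^~ s) (gegenbauer_kernelE P1 m).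
  by rewrite (_ : m.+1 = l + e)%N ?hornerM ?hornerD ?hornerN ?hornerX ?hornerC//; lia.
rewrite -hornerN -hornerD US.
have -> : (l + n + e - 3 = n + m - 2)%N by lia.
have -> : (2 * l + n + 2 * e - 3)%:R = 2 * m%:R + n%:R - 1 :> R.
  rewrite (_ : 2 * l + n + 2 * e - 3 = 2 * m + n - 1)%N; last by lia.
  by rewrite castE.
rewrite natrB; last by rewrite ltnW.
congr (_ * (_ - _)).
rewrite (_ : e%:R * (P l).[s] + (P (l + e)).[s] = Q.[s]); last first.
  by rewrite hornerD hornerZ.
have s0 : 1 - s != 0 by rewrite subr_eq0 gt_eqF//; case/andP: s1.
by rewrite mulrCA -mulf_div divff// mul1r.
Qed.

(* If Q(s) = 0 (where Rocq's division gives 0) or U(s) = 0, then L_q(n, s) is at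
   most D(n, q). *)
Lemma lev_value_bound : lev_value n P l e s > (lev_D n tau)%:R ->
  Q.[s] != 0 /\ (gegenbauer_kernel P m).[s] != 0.
Proof.
have [I IE] := mu_int_scalar R n2.
have Porth k : is_orthogonal_poly I k (P k) by rewrite IE; exact: (gegenbauer_spec R n2 k).1.
have Ipos : pos_functional I by rewrite IE; exact: mu_int_pos.
have Ider p : I ((1 - 'X ^+ 2) * p^`()) = (n%:R - 1) * I ('X * p).
  by rewrite IE mu_int_deriv.
have h : 'C(n + m - 2, n - 2)%:R * (gegenbauer_kernel P m).[1] <= (lev_D n tau)%:R.
  rewrite (gegenbauer_kernel_at1 n2 Ipos Ider Porth P1).
  have n1 : 0 < n%:R - 1 :> R by rewrite subr_gt0 ltr1n.
  rewrite mulrA ler_pdivrMr//.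
  have -> : n%:R - 1 = (n - 1)%:R :> R by rewrite natrB// ltnW.
  rewrite -castE.
  by rewrite -!natrM ler_nat; exact: lev_D_bound.
rewrite /lev_value => hD; split; apply/eqP => h0; move: hD.
  by rewrite h0 invr0 mulr0 subr0 ltNge h.
by rewrite h0 mulr0 mul0r subr0 ltNge h.
Qed.

Lemma lev_data : lev_interval n tau s -> (lev_D n tau)%:R < lev_L n tau s ->
  exists (Y : seq R) , let A := (if e then [:: -1] else [::]) ++ rcons Y s in
  [/\ rootsR (lev_poly n tau s) = A, size Y = (l - 1)%N, uniq (1 :: A),
     forall z, z \in A -> -1 <= z <= s
   & forall f : {poly R}, (size f <= l + l + e)%N -> mu_int n f = f.[1] / lev_L n tau s +
       \sum_(z <- A) f.[z] * ((mu_int n (node_poly A z) -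
         (node_poly A z).[1] / lev_L n tau s) / (node_poly A z).[z])].
Proof.
rewrite /lev_interval lev_lE// lev_eE// lev_LE /= in_itv/= => /andP[top_le _].
move=> /lev_value_bound[Qs Us].
have [I IE] := mu_int_scalar R n2.
have Porth k : is_orthogonal_poly I k (P k) by rewrite IE; exact: (gegenbauer_spec R n2 k).1.
have Ipos : pos_functional I by rewrite IE; exact: mu_int_pos.
have Ider p : I ((1 - 'X ^+ 2) * p^`()) = (n%:R - 1) * I ('X * p).
  by rewrite IE mu_int_deriv.
have I1 : I 1 = 1 by rewrite IE mu_int1.
have jorth := jacobi_spec n2 (~~ e) m IE.
have jle z := jacobi_top_ge n2 (z := z) IE top_le.
set jac := jacobi _ _ _ in jorth jle.
pose J : {scalar {poly R}} := weighted I ((1 - 'X) * (1 + 'X) ^+ e).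
pose J' : {scalar {poly R}} := weighted I ((1 - 'X) * (1 + 'X) ^+ (~~ e)).
have wpos (b : bool) : pos_functional (weighted I ((1 - 'X) * (1 + 'X) ^+ b)).
  apply: pos_weighted => //; first by rewrite mulf_neq0 ?onemX_neq0// expf_neq0 ?onepX_neq0.
  move=> t /andP[? ?]; rewrite hornerM horner_exp mulr_ge0 ?exprn_ge0// !hornerE; lra.
(* For e = 1, [jac] has degree l >= 1, hence a zero in ]-1, 1[, and s is at least that zero. *)
have es1 : e -> -1 < s.
  move=> e1; have jac0 : jac != 0 by rewrite -size_poly_eq0 jorth.1.
  have [Z [_ rZ iZ]] := orth_roots (J := J') (@wpos _) jac0 jorth.2.
  rewrite e1 addn1 subn1 prednK//; case: Z rZ iZ => [|z Z] /=; first by rewrite leqNgt l1.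
  move=> /andP[rz _] /andP[/andP[z1 _] _] _.
  by rewrite (lt_le_trans z1)// jle.
have [Y [K [c /= [sY uA Ale [c0 KE Krep] quad]]]] := lev_nodes_exist
  n2 Ipos I1 Ider Porth P1 l1 s1 (J := J) (J' := J') (fun=> erefl) (fun=> erefl)
  jorth jle es1 Qs (fun=> Us).
set A0 := _ ++ s :: Y in uA Ale quad.
have kerE : lev_kernel n tau s = K.
  have sK : (size K <= l)%N by rewrite KE size_scale// size_prod_XsubC sY subn1 prednK.
  rewrite /lev_kernel lev_lE// lev_eE//; apply: xget_unique.
    by split => // p sp; rewrite -IE -[RHS](Krep p sp).
  (* The difference d of two representing polynomials satisfies J(d^2) = d(s) - d(s) = 0. *)
  move=> K' [sK' K'rep]; apply/eqP; rewrite -subr_eq0; apply/negPn/negP => KK0.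
  have sKK : (size (K' - K)%R <= l)%N.
    by rewrite (leq_trans (size_polyD _ _))// size_polyN geq_max sK'.
  have r1 : J (K' * (K' - K)) = (K' - K).[s] by rewrite -(K'rep _ sKK) -IE.
  have r2 : J (K * (K' - K)) = (K' - K).[s] := Krep _ sKK.
  have := pos_sqr (J := J) (@wpos e) KK0.
  rewrite expr2 [X in J X](_ : _ = K' * (K' - K) - K * (K' - K)); last by rewrite -mulrBl.
  by rewrite (linearB J) r1 r2 subrr ltxx.
pose f0 : {poly R} := (1 + 'X) ^+ e * ('X - s%:P) * K ^+ 2.
have K0 : K != 0.
  by rewrite KE scale_poly_eq0 negb_or c0 monic_neq0// monic_prod_XsubC.
have f00 : f0 != 0.
  apply: mulf_neq0; last exact: expf_neq0.
  by apply: mulf_neq0; [apply/expf_neq0/onepX_neq0|rewrite polyXsubC_eq0].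
have polyE : lev_poly n tau s = (lead_coef f0)^-1 *: f0.
  by rewrite /lev_poly lev_eE// kerE.
have lf0 : lead_coef f0 != 0 by rewrite lead_coef_eq0.
have poly0 : lev_poly n tau s != 0 by rewrite polyE scale_poly_eq0 negb_or invr_eq0 lf0 f00.
have memA z : (z \in A0) = (e && (z == -1)) || (z == s) || (z \in Y).
  by rewrite /A0 mem_cat inE orbA; case: e => //=; rewrite mem_seq1.
have rootA z : root (lev_poly n tau s) z = (z \in A0).
  rewrite polyE rootZ ?invr_eq0// /f0 !rootM root_XsubC orbb.
  rewrite KE rootZ// root_prod_XsubC memA; congr (_ || _ || _).
  case: e => /=; last by rewrite expr0 (negPf (root1 z)).
  by rewrite expr1 rootE !hornerE addrC addr_eq0.
have [uA1 uA2] := andP (uA : (1 \notin A0) && uniq A0).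
have uY : uniq Y by move: uA2; rewrite /A0 cat_uniq /= => /and4P[].
have sNY : s \notin Y by move: uA2; rewrite /A0 cat_uniq /= => /and4P[].
(* [lev_node] indexes the increasing list of roots, whereas Y comes in no particular order. *)
pose Ys := sort <=%R Y.
pose A := (if e then [:: -1] else [::]) ++ rcons Ys s.
have pA : perm_eq A0 A.
  by rewrite perm_cat2l perm_sym perm_rcons perm_cons perm_sort.
have sYs : sorted <%R Ys by rewrite sort_lt_sorted.
have memYs y : y \in Ys -> -1 <= y < s /\ (e -> y != -1).
  rewrite mem_sort => yY; have yA : y \in A0 by rewrite memA yY orbT.
  have /andP[-> ys] := Ale y yA.
  split; first by rewrite lt_neqAle ys andbT; apply: contraNneq sNY => <-.
  move=> e1; apply: contraTneq uA2 => yN1.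
  by rewrite /A0 e1 /= inE negb_or -yN1 yY andbF.
have rcs : sorted <%R (rcons Ys s).
  case: Ys sYs memYs {A pA} => [//|y r] /= yr memYs; rewrite rcons_path yr/=.
  by have [/andP[_ ->]] := memYs _ (mem_last y r).
have sA : sorted <%R A.
  rewrite /A; case: e memYs es1 => [memYs es1|//] /=.
  rewrite (path_sortedE lt_trans) rcs andbT; apply/allP => y.
  rewrite mem_rcons inE => /predU1P[->|yY]; first exact: es1.
  have [/andP[y1 _] yN1] := memYs y yY.
  by rewrite lt_neqAle y1 eq_sym yN1.
exists Ys; rewrite -/A; split.
- apply: Order.POrderTheory.lt_sorted_eq => //; first exact: sorted_roots.
  by move=> z; rewrite mem_rootsR// rootA (perm_mem pA).
- by rewrite size_sort.
- by rewrite /= -(perm_mem pA) uA1/= -(perm_uniq pA).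
- by move=> z; rewrite -(perm_mem pA); exact: Ale.
- move=> f sf; have := quad f sf; rewrite IE => ->; congr (_ + _).
  rewrite (perm_big _ pA); apply: eq_bigr => z _.
  by rewrite /node_poly !(perm_big _ pA).
Qed.

End LevenshteinData.

Section SphericalCodes.
Variables (R : realType) (n N : nat).
Implicit Types (x : 'I_N -> 'rV[R]_n) (w : 'I_N -> R).

Lemma dotp_geN1 (u v : 'rV[R]_n) : dotp u u = 1 -> dotp v v = 1 -> -1 <= dotp u v.
Proof.
move=> u1 v1.
have : 0 <= \sum_(k < n) (u 0 k + v 0 k) ^+ 2 by apply: sumr_ge0 => k _; rewrite sqr_ge0.
have -> : \sum_(k < n) (u 0 k + v 0 k) ^+ 2 = dotp u u + dotp u v *+ 2 + dotp v v.
  rewrite /dotp -sumrMnl -!big_split; apply: eq_bigr => k _ /=.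
  by rewrite sqrrD !expr2.
rewrite u1 v1; lra.
Qed.

(** Descent on the degree d, subtracting a multiple of P_d: for d >= 1 the design condition and
    orthogonality to 1 make both sides 0 on P_d; for d = 0 the weights sum to 1. *)
Lemma design_average x w tau (p : {poly R}) : (2 <= n)%N ->
  weighted_code x w -> weighted_design x w tau -> (size p <= tau.+1)%N ->
  \sum_(i < N) \sum_(j < N) w i * w j * p.[dotp (x i) (x j)] = mu_int n p.
Proof.
move=> n2 [_ _ _ w1] des; have [I IE] := mu_int_scalar R n2.
pose S (p : {poly R}) := \sum_(i < N) \sum_(j < N) w i * w j * p.[dotp (x i) (x j)].
have SD a p' q : S (a *: p' + q) = a * S p' + S q.
  rewrite /S mulr_sumr -big_split; apply: eq_bigr => i _ /=.
  rewrite mulr_sumr -big_split; apply: eq_bigr => j _ /=.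
  by rewrite hornerD hornerZ; ring.
rewrite -IE -/(S p).
have [k] := ubnP (size p); elim: k p => // k IH p /ltnSE sp st.
have [->|p0] := eqVneq p 0.
  rewrite linear0 /S big1// => i _; rewrite big1// => j _.
  by rewrite horner0 mulr0.
have sp0 : (0 < size p)%N by rewrite size_poly_gt0.
set d := (size p).-1; pose P := gegenbauer R n d.
have [[sP Porth] P1] := gegenbauer_spec R n2 d.
have lP0 : lead_coef P != 0 by rewrite lead_coef_eq0 -size_poly_eq0 sP.
pose a := lead_coef p / lead_coef P.
have sq : (size (p - a *: P)%R <= d)%N.
  apply/leq_sizeP => j; rewrite leq_eqVlt => /predU1P[<-|dj].
    rewrite coefB coefZ /a !lead_coefE sP /= -/d divfK ?subrr//.
    by move: lP0; rewrite lead_coefE sP.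
  by rewrite coefB coefZ !nth_default ?mulr0 ?subrr// ?sP// -(prednK sp0).
have IP : S P = I P.
  have [d0|d0] := posnP d; last first.
    rewrite IE -[P in RHS]mulr1 Porth ?size_poly1// /S; apply: des.
    by rewrite d0 -ltnS prednK.
  have PE : P = 1.
    have /size_poly1P[c c0 cE] : size P == 1%N by rewrite sP d0.
    by move: P1; rewrite -/P cE hornerC => ->.
  rewrite PE IE mu_int1// /S.
  under eq_bigr do under eq_bigr do rewrite hornerC mulr1.
  by under eq_bigr do rewrite -mulr_sumr w1 mulr1.
have -> : p = a *: P + (p - a *: P) by rewrite subrKC.
rewrite SD IP IH; last 2 first.
- by rewrite (leq_trans _ sp)// -[X in (_ < X)%N](prednK sp0) ltnS.
- by rewrite (leq_trans sq)// (leq_trans (leq_pred _)).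
by rewrite linearP.
Qed.

End SphericalCodes.

(** * Indexed nodes and weights, and the multiset T *)

Section LevenshteinNodes.
Variables (R : realType) (n l : nat) (e : bool) (s : R) (Y : seq R).
Local Notation tau := (2 * l - 1 + e)%N.
Local Notation A := ((if e then [:: -1] else [::]) ++ rcons Y s).
Hypothesis l1 : (1 <= l)%N.
Hypothesis rootsE : rootsR (lev_poly n tau s) = A.
Hypothesis sY : size Y = (l - 1)%N.
Hypothesis uA : uniq A.

Lemma lev_nodeE i : lev_node n tau s i = A`_i.
Proof. by rewrite /lev_node rootsE. Qed.

Let sizeA : size A = (l + e)%N.
Proof. by rewrite size_cat size_rcons sY subn1 prednK//; case: e => /=; rewrite ?add1n ?addn1 ?addn0. Qed.

Lemma lev_weightE i : (i < l + e)%N -> lev_weight n tau s i =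
  (mu_int n (node_poly A A`_i) - (node_poly A A`_i).[1] / lev_L n tau s) /
  (node_poly A A`_i).[A`_i].
Proof.
move=> il; rewrite /lev_weight lev_lE// lev_eE//.
have -> : \prod_(j < l + e | j != i :> nat) ('X - (lev_node n tau s j)%:P) = node_poly A A`_i.
  rewrite /node_poly (big_nth 0) sizeA big_mkord; apply: eq_big => [j|j _].
    by rewrite nth_uniq ?sizeA.
  by rewrite lev_nodeE.
by rewrite lev_nodeE.
Qed.

Lemma lev_multisetE : lev_multiset n tau s =
  (if e then [:: -1] else [::]) ++ rcons (Y ++ Y) s.
Proof.
rewrite /lev_multiset lev_lE// lev_eE//.
have mapY k : (forall i, (i < l - 1)%N -> A`_(k + i) = Y`_i) ->
    [seq lev_node n tau s i | i <- iota k (l - 1)] = Y.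
  move=> kA; apply: (@eq_from_nth _ 0); rewrite size_map size_iota// => i il.
  by rewrite (nth_map 0) ?size_iota// nth_iota// lev_nodeE kA.
have iY i : (i < l - 1)%N -> (rcons Y s)`_i = Y`_i by move=> il; rewrite nth_rcons sY il.
have [e1|/negPf e0] : e \/ ~~ e by case: e; [left|right].
- have ifE (T : Type) (a b : T) : (if e then a else b) = a by rewrite e1.
  rewrite !ifE map_cat mapY => [|i il]; last by rewrite ifE /= iY.
  have sl : (-1 :: rcons Y s)`_l = s.
    by rewrite -(prednK l1) /= nth_rcons sY subn1 ltnn eqxx.
  by rewrite !lev_nodeE !ifE /= sl cats1.
- have ifE (T : Type) (a b : T) : (if e then a else b) = b by rewrite e0.
  rewrite !ifE map_cat mapY => [|i il]; last by rewrite ifE /= iY.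
  have sl : (rcons Y s)`_(l - 1) = s by rewrite nth_rcons sY ltnn eqxx.
  by rewrite lev_nodeE ifE /= sl cats1.
Qed.

End LevenshteinNodes.

Unset Implicit Arguments.

Theorem theorem5p6 (R : realType) (n l : nat) (e : bool) (tau : nat)
  (hn : (2 <= n)%N) (hl : (1 <= l)%N) (htau : tau = (2 * l - 1 + e)%N)
  (h : R -> \bar R) (hpot : potential h) (hder : nth_derivative_ge0 h tau)
  (N : nat) (x : 'I_N -> 'rV[R]_n) (w : 'I_N -> R)
  (hcode : weighted_code x w) (hdesign : weighted_design x w tau)
  (s : R) (hs : s = max_inner x) (hs1 : -1 <= s < 1)
  (hI : lev_interval n tau s)
  (Nq : R) (hNq : Nq = lev_L n tau s)
  (hD : (lev_D n tau)%:R < Nq <= (lev_D n tau.+1)%:R) :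
  let NW := weight_card w in
  (energy h x w <=
     ((NW - Nq) * (lev_interpolant n tau h s).[1] / (NW * Nq))%:E
     + \sum_(i < l + e)
         (lev_weight n tau s i)%:E * h (lev_node n tau s i))%E.
Proof.
cbv zeta; set NW := weight_card w; case/andP: hD => Dlt _.
have Nq0 : 0 < Nq by rewrite (le_lt_trans _ Dlt).
move: hI hNq Dlt hdesign hder; rewrite htau => hI hNq Dlt hdesign [der ge0].
rewrite hNq in Dlt.
have [Y [rootsE sY uA1 Ale quad]] := lev_data hn hl hs1 hI Dlt.
set A := _ ++ rcons Y s in rootsE uA1 Ale quad.
have [A1 uA] := andP (uA1 : (1 \notin A) && uniq A).
have sA : size A = (l + e)%N.
  by rewrite size_cat size_rcons sY subn1 prednK//; case: (e) => /=; rewrite ?add1n ?addn1 ?addn0.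
have uY : uniq Y.
  by move: uA; rewrite /A cat_uniq rcons_uniq => /and3P[_ _ /andP[]].
have YA : {subset Y <= A}.
  by move=> y yY; rewrite /A mem_cat mem_rcons inE yY !orbT.
have [sN1 slt1] := andP hs1.
pose f t := fine (h t).
(* Finiteness comes from s < 1, so the comparison can run in R. *)
have hf t : -1 <= t <= s -> h t = (f t)%:E.
  move=> /andP[t1 ts]; rewrite fineK//; have [_ _ hfin] := hpot.
  by apply: hfin; rewrite t1 (le_lt_trans ts).
have tauk : (2 * l - 1 + e)%N = (2 * l - 2 + e).+1.
  by move: hl; clear; lia.
have TE := lev_multisetE hl rootsE sY.
set T := lev_multiset _ _ _ in TE.
have memT t : (t \in T) = (t \in A).
  by rewrite TE /A !mem_cat !mem_rcons !inE mem_cat orbb.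
have countT t : count_mem t T = (count_mem t A + count_mem t Y)%N.
  by rewrite TE /A !count_cat -!cats1 !count_cat; clear; lia.
have sAY : (size A + size Y)%N = (2 * l - 1 + e)%N 
  by rewrite sA sY; move: hl; clear; lia.
pose g := lev_interpolant n (2 * l - 1 + e) h s.
have [sg gA gY] : [/\ (size g <= 2 * l - 1 + e)%N, forall a, a \in A -> g.[a] = f a
    & forall y, y \in Y -> g^`().[y] = derive_within `[-1, 1[%classic f y].
  (* A witness is needed for the choice behind [lev_interpolant] to meet its conditions;
     multiplicity 2 in T means membership in both A and Y. *)
  have [g0 [sg0 g0A g0Y]] := hermite_exists f
    (derive_within `[-1, 1[%classic f) uA uY YA.
  have := @xgetPex _ (0 : {poly R}) [set g : {poly R} | [/\ (size g <= 2 * l - 1 + e)%N,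
    forall t, t \in T -> g.[t] = fine (h t)
  & forall t, (2 <= count_mem t T)%N ->
      (g^`()).[t] = derive_within `[-1, 1[%classic (fine \o h) t]].
  case=> [|sg gT gT'].
    exists g0; split; first by rewrite -sAY.
      by move=> t; rewrite memT; exact: g0A.
    move=> t; rewrite countT (count_uniq_mem _ uA) (count_uniq_mem _ uY) => ct.
    by apply: g0Y; move: ct; case: (t \in Y) => //; rewrite addn0; case: (t \in A).
  split => //.
    by move=> a aA; apply: gT; rewrite memT.
  move=> y yY; apply: gT'.
  by rewrite countT (count_uniq_mem _ uA) (count_uniq_mem _ uY) yY YA.
have fg t : -1 <= t <= s -> f t <= g.[t].
  move=> ts; move: der ge0 sg sAY; rewrite tauk => der ge0 sg sAY.
  apply: (@hermite_upper_bound R f _ _ _ A Y g s uA uY YA slt1 Ale sAY sg gA gY t ts) => //.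
  (* The node polynomial is (t - s)(1 + t)^e times a square, so on [-1, s] it has the sign of t -
     s. *)
  rewrite hornerM /A big_cat -cats1 big_cat big_seq1 /=.
  rewrite !hornerM hornerXsubC.
  rewrite (_ : _ * _ * _ = (t - s) * ((\prod_(i <- (if e then [:: -1] else [::])) ('X - i%:P)).[t] *
     (\prod_(y <- Y) ('X - y%:P)).[t] ^+ 2)); last by ring.
  rewrite mulr_le0_ge0 ?subr_le0//; first by case/andP: ts.
  rewrite mulr_ge0 ?sqr_ge0//; case: (e); rewrite ?big_nil ?hornerC//.
  by rewrite big_seq1 hornerXsubC opprK -lerBlDr sub0r; case/andP: ts.
have [xunit _ wpos w1] := hcode.
have dots i j : j != i -> -1 <= dotp (x i) (x j) <= s.
  move=> ji; rewrite dotp_geN1//= hs /max_inner.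
  have := @le_bigmax_cond _ _ _ (-1 : R) (i, j) (fun ij : 'I_N * 'I_N => ij.1 != ij.2)
    (fun ij => dotp (x ij.1) (x ij.2)).
  by apply; rewrite /= eq_sym.
have -> : energy h x w =
    (\sum_(i < N) \sum_(j < N | j != i) w i * w j * f (dotp (x i) (x j)))%:E.
  rewrite /energy -sumEFin; apply: eq_bigr => i _; rewrite -sumEFin.
  by apply: eq_bigr => j ji; rewrite hf ?dots.
have -> : (\sum_(i < l + e) (lev_weight n (2 * l - 1 + e) s i)%:E *
      h (lev_node n (2 * l - 1 + e) s i))%E =
    (\sum_(z <- A) f z * ((mu_int n (node_poly A z) -
         (node_poly A z).[1] / Nq) / (node_poly A z).[z]))%:E.
  rewrite (big_nth 0) sA big_mkord -sumEFin; apply: eq_bigr => i _.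
  rewrite (lev_weightE hl rootsE sY uA) // (lev_nodeE rootsE) -hNq.
  by rewrite hf ?Ale ?mem_nth ?sA// -EFinM mulrC.
rewrite -EFinD lee_fin.
have avg : \sum_(i < N) \sum_(j < N) w i * w j * g.[dotp (x i) (x j)] = mu_int n g.
  by apply: (design_average hn hcode hdesign); rewrite (leq_trans sg).
have W0 : 0 < \sum_(i < N) w i ^+ 2.
  rewrite lt_neqAle eq_sym sumr_ge0 ?andbT => [|i _]; last exact: sqr_ge0.
  apply/eqP => /eqP; rewrite psumr_eq0 => [/allP w0|i _]; last exact: sqr_ge0.
  move: w1; rewrite big1 => [/eqP|i _]; first by rewrite eq_sym oner_eq0.
  by have := w0 i (mem_index_enum _); rewrite /= expf_eq0/= => /eqP.
have diag : \sum_(i < N) \sum_(j < N | j != i) w i * w j * g.[dotp (x i) (x j)] =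
    mu_int n g - g.[1] * \sum_(i < N) w i ^+ 2.
  rewrite -avg mulr_sumr -sumrB; apply: eq_bigr => i _.
  rewrite [in RHS](bigD1 i)//= xunit; ring.
have le1 : \sum_(i < N) \sum_(j < N | j != i) w i * w j * f (dotp (x i) (x j)) <=
    mu_int n g - g.[1] * \sum_(i < N) w i ^+ 2.
  rewrite -diag; apply: ler_sum => i _; apply: ler_sum => j ji.
  by rewrite ler_wpM2l ?mulr_ge0 ?(ltW (wpos _))// fg// dots.
apply: (le_trans le1).
rewrite (quad g); last first.
  by rewrite (leq_trans sg)//; move: hl; clear; lia.
rewrite -hNq -/g.
have -> : \sum_(z <- A) g.[z] * ((mu_int n (node_poly A z) - (node_poly A z).[1] / Nq) /
      (node_poly A z).[z]) = \sum_(z <- A) f z * ((mu_int n (node_poly A z) -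
      (node_poly A z).[1] / Nq) / (node_poly A z).[z]).
  by apply: eq_big_seq => z zA; rewrite gA.
rewrite -addrAC lerD2r /NW /weight_card.
move: (\sum_(i < N) _) W0 => W W0.
(* With W = 1 / N_W both sides equal g(1) (1 / N_q - W). *)
rewrite le_eqVlt; apply/orP; left; apply/eqP; field.
by rewrite !gt_eqF.
Qed.
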